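(* Let $A$ be a dense subset of a uniform space $X$ and let $G$ be an internal abelian group. Then the $\mu$-homology of $A$ is isomorphic to the $\mu$-homology of $X$: $H_\bullet(A;G)\cong H_\bullet(X;G)$.
   Context: Nonstandard setting: fix a standard universe $\mathbb{U}$ satisfying sufficiently many axioms of ZFC and containing all standard objects considered (uniform spaces are standard), and an elementary extension ${}^{\ast}\mathbb{U}$ of $\mathbb{U}$ (the internal universe) that is $|\mathbb{U}|^{+}$-saturated; $x\mapsto{}^{\ast}x$ is the elementary embedding. ''Internal'' means belonging to ${}^{\ast}\mathbb{U}$; ''hyperfinite'' means finite in the sense of ${}^{\ast}\mathbb{U}$. For a uniform space $X$, points $x,y\in{}^{\ast}X$ are infinitely close, $x\approx y$, if $(x,y)\in{}^{\ast}U$ for every entourage $U$ of $X$. Subsets of uniform spaces carry the subspace uniformity. $\mu$-homology: $C_p(X;G)$ is the internal abelian group of hyperfinite formal sums $\sum_{i=0}^{n}g_i\sigma_i$ with $\{g_i\}_{i=0}^n$ and $\{\sigma_i\}_{i=0}^n$ internal hyperfinite sequences in $G$ and in ${}^{\ast}X^{p+1}$ respectively (equivalently, internal functions ${}^{\ast}X^{p+1}\to G$ with hyperfinite support). A $p$-microsimplex is $(a_0,\ldots,a_p)\in{}^{\ast}X^{p+1}$ with $a_i\approx a_j$ for all $i,j\le p$. $M_p(X;G)\subseteq C_p(X;G)$ is the subgroup of $p$-microchains, i.e. elements representable as $\sum_{i=0}^n g_i\sigma_i$ with $\{g_i\}$, $\{\sigma_i\}$ internal hyperfinite sequences and every $\sigma_i$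 a $p$-microsimplex; $M_p=0$ for $p<0$. The boundary $\partial_p:M_p(X;G)\to M_{p-1}(X;G)$ is the restriction of the internal homomorphism determined by $\partial_p(a_0,\ldots,a_p)=\sum_{i=0}^p(-1)^i(a_0,\ldots,\hat a_i,\ldots,a_p)$ ($\partial_0=0$). $H_\bullet(X;G)$ is the homology of the chain complex $M_\bullet(X;G)$. *)

(* Defs.v *)
From HB Require Import structures.
From mathcomp Require Import all_boot.
From mathcomp Require Import boolp classical_sets functions.

Set Implicit Arguments.
Unset Strict Implicit.
Unset Printing Implicit Defensive.

Local Open Scope classical_set_scope.

(* Structures for the language of set theory (nonempty, as usual in model
   theory).  The membership relation need be neither transitive nor well
   founded, so both the standard and the internal universe are of this kind. *)
Record eps_structure := EpsStructure {
  carrier :> pointedType;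
  eps : carrier -> carrier -> Prop }.

Notation "x \eps y" := (eps x y) (at level 70, no associativity).

(* Formulas with de Bruijn indices: [fAll] binds the variable 0. *)
Inductive form : Type :=
| fMem of nat & nat
| fEq of nat & nat
| fBot
| fImp of form & form
| fAll of form.

Definition scons (T : Type) (x : T) (e : nat -> T) (n : nat) : T :=
  if n is m.+1 then e m else x.

Fixpoint sat (M : eps_structure) (e : nat -> M) (phi : form) : Prop :=
  match phi with
  | fMem i j => e i \eps e j
  | fEq i j => e i = e j
  | fBot => False
  | fImp phi1 phi2 => sat e phi1 -> sat e phi2
  | fAll psi => forall x : M, sat (scons x e) psi
  end.

Definition elementary (M N : eps_structure) (j : M -> N) : Prop :=
  forall (phi : form) (e : nat -> M), sat e phi <-> sat (j \o e) phi.

(* |K|^+-saturation, K infinite: a one-variable type [T] whose parameters lie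
   in a set of cardinality at most |K|, namely the range of [a], is realised as
   soon as it is finitely satisfiable. *)
Definition succ_saturated (K : Type) (M : eps_structure) : Prop :=
  forall (a : K -> M) (T : form -> (nat -> K) -> Prop),
    (forall (n : nat) (q : 'I_n -> form * (nat -> K)),
       (forall i, T (q i).1 (q i).2) ->
       exists x : M, forall i, sat (scons x (a \o (q i).2)) (q i).1) ->
    exists x : M, forall phi e, T phi e -> sat (scons x (a \o e)) phi.

Section SetTheory.
Context {M : eps_structure}.
Implicit Types (x y z a b f g s A B n w : M).

(* The set { z | P z }; meaningful only if the class P is a set of M. *)
Definition setof (P : set M) : M := get [set s | forall z, z \eps s <-> P z].

Definition esub A B : Prop := forall z, z \eps A -> z \eps B.
Definition eempty : M := setof set0.
Definition eupair x y : M := setof [set z | z = x \/ z = y].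
Definition opair x y : M := eupair (eupair x x) (eupair x y).
Definition eprod A B : M :=
  setof [set z | exists x y, [/\ x \eps A, y \eps B & z = opair x y]].
Definition esucc n : M := setof [set z | z \eps n \/ z = n].

Definition inductive w : Prop :=
  eempty \eps w /\ forall n, n \eps w -> esucc n \eps w.
Definition is_nat n : Prop := forall w, inductive w -> n \eps w.

Definition is_fun f A B : Prop :=
  esub f (eprod A B) /\
  forall x, x \eps A -> exists! y, opair x y \eps f.
Definition app f x : M := get [set y | opair x y \eps f].
Definition lam A (F : M -> M) : M :=
  setof [set z | exists x, x \eps A /\ z = opair x (F x)].

Definition is_finite s : Prop :=
  exists n f, [/\ is_nat n, is_fun f n s,
    forall i j, i \eps n -> j \eps n -> app f i = app f j -> i = j &
    forall y, y \eps s -> exists i, i \eps n /\ app f i = y].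

End SetTheory.

(* Zermelo set theory with choice; neither replacement nor foundation. *)
Record ZC (M : eps_structure) : Prop := {
  zc_ext : forall x y : M, (forall z, z \eps x <-> z \eps y) -> x = y;
  zc_pairing : forall x y : M, exists s, forall z, z \eps s <-> z = x \/ z = y;
  zc_union : forall x : M, exists s, forall z,
    z \eps s <-> exists y, y \eps x /\ z \eps y;
  zc_power : forall x : M, exists s, forall z, z \eps s <-> esub z x;
  zc_separation : forall (phi : form) (e : nat -> M) (x : M), exists s,
    forall z, z \eps s <-> z \eps x /\ sat (scons z e) phi;
  zc_infinity : exists w : M, inductive w;
  zc_choice : forall F : M,
    (forall x, x \eps F -> exists y, y \eps x) ->
    (forall x y z, x \eps F -> y \eps F -> z \eps x -> z \eps y -> x = y) ->
    exists T, forall x, x \eps F -> exists! z, z \eps x /\ z \eps T }.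

Section UniformSpaces.
Context {M : eps_structure}.
Implicit Types (X Ent A V W N x y z : M).

Record uniform_space X Ent : Prop := {
  unif_sub : forall V, V \eps Ent -> esub V (eprod X X);
  unif_full : eprod X X \eps Ent;
  unif_up : forall V W, V \eps Ent -> esub V W -> esub W (eprod X X) ->
    W \eps Ent;
  unif_cap : forall V W, V \eps Ent -> W \eps Ent ->
    setof [set z | z \eps V /\ z \eps W] \eps Ent;
  unif_refl : forall V x, V \eps Ent -> x \eps X -> opair x x \eps V;
  unif_sym : forall V, V \eps Ent -> exists W, W \eps Ent /\
    forall x y, opair x y \eps W -> opair y x \eps V;
  unif_comp : forall V, V \eps Ent -> exists W, W \eps Ent /\
    forall x y z, opair x y \eps W -> opair y z \eps W -> opair x z \eps V }.

Definition sub_uniformity A Ent : M :=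
  setof [set W | exists V, V \eps Ent /\
    W = setof [set z | z \eps V /\ z \eps eprod A A]].

Definition is_nbhd X Ent x N : Prop :=
  esub N X /\ exists V, V \eps Ent /\ forall y, opair x y \eps V -> y \eps N.

Definition dense_in X Ent A : Prop :=
  esub A X /\ forall x N, x \eps X -> is_nbhd X Ent x N ->
    exists a, a \eps A /\ a \eps N.

End UniformSpaces.

Section AbelianGroups.
Context {M : eps_structure}.
Implicit Types (G plus x y z e : M).

Definition gadd plus x y : M := app plus (opair x y).

Record abelian_group G plus : Prop := {
  gadd_fun : is_fun plus (eprod G G) G;
  gaddA : forall x y z, x \eps G -> y \eps G -> z \eps G ->
    gadd plus x (gadd plus y z) = gadd plus (gadd plus x y) z;
  gaddC : forall x y, x \eps G -> y \eps G -> gadd plus x y = gadd plus y x;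
  gadd_zero_opp : exists e, [/\ e \eps G,
    forall x, x \eps G -> gadd plus e x = x &
    forall x, x \eps G -> exists y, y \eps G /\ gadd plus x y = e] }.

Definition gzero G plus : M :=
  get [set e | e \eps G /\ forall x, x \eps G -> gadd plus e x = x].
Definition gopp G plus x : M :=
  get [set y | y \eps G /\ gadd plus x y = gzero G plus].

End AbelianGroups.

(* Everything below is meant inside the structure M; with M the internal
   universe, [is_finite] is hyperfiniteness, and an element of M is the same
   thing as an internal object. *)
Section Chains.
Context {M : eps_structure} (X G plus : M).
Implicit Types (c d g sigma tau n P D : M).

(* X^n consists of the codes (a_0, (a_1, (... (a_(n-1), {}) ...))). *)
Fixpoint epow (n : nat) : M :=
  if n is m.+1 then eprod X (epow m) else eupair eempty eempty.
Definition code (n : nat) (a : 'I_n -> M) : M :=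
  foldr opair eempty [seq a i | i <- enum 'I_n].

Definition face (p : nat) (i : 'I_p.+2) (a : 'I_p.+2 -> M) : 'I_p.+1 -> M :=
  fun k => a (lift i k).

Definition chains (p : nat) : M :=
  setof [set c | is_fun c (epow p.+1) G /\
    exists s, [/\ is_finite s, esub s (epow p.+1) &
      forall sigma, sigma \eps epow p.+1 -> ~ sigma \eps s ->
        app c sigma = gzero G plus]].

Definition czero (p : nat) : M := lam (epow p.+1) (fun=> gzero G plus).
Definition cadd (p : nat) (c d : M) : M :=
  lam (epow p.+1) (fun sigma => gadd plus (app c sigma) (app d sigma)).
(* The one-term formal sum g sigma. *)
Definition cterm (p : nat) (g sigma : M) : M :=
  lam (epow p.+1) (fun tau => if tau == sigma then g else gzero G plus).

Definition gsign (i : nat) (g : M) : M := if odd i then gopp G plus g else g.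

(* c = \sum_(i < n) g_i sigma_i, for n a natural number of M and g, sigma
   sequences in M; P is the sequence of partial sums.  The sum is allowed to be
   empty, so that 0 is such a sum even if X is empty. *)
Definition formal_sum (p : nat) (n g sigma c : M) : Prop :=
  exists P, [/\ is_fun P (esucc n) (chains p),
    app P eempty = czero p,
    forall i, i \eps n ->
      app P (esucc i) = cadd p (app P i) (cterm p (app g i) (app sigma i)) &
    app P n = c].

(* The homomorphism C_(p+1) -> C_p of M determined on generators by the
   alternating sum of the faces. *)
Definition is_bd (p : nat) (D : M) : Prop :=
  [/\ is_fun D (chains p.+1) (chains p),
      forall c d, c \eps chains p.+1 -> d \eps chains p.+1 ->
        app D (cadd p.+1 c d) = cadd p (app D c) (app D d) &
      forall (g : M) (a : 'I_p.+2 -> M), g \eps G -> (forall i, a i \eps X) ->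
        app D (cterm p.+1 g (code a)) =
        \big[cadd p/czero p]_(i < p.+2) cterm p (gsign i g) (code (face i a))].
Definition bd (p : nat) (c : M) : M := app (get [set D | is_bd p D]) c.

End Chains.

Section MuHomology.
Context {U I : eps_structure} (star : U -> I).
Context (X Ent : U) (G plus : I).
Local Notation sX := (star X).

Definition near (x y : I) : Prop :=
  forall V : U, V \eps Ent -> opair x y \eps star V.

Definition microsimplex (p : nat) (sigma : I) : Prop :=
  exists a : 'I_p.+1 -> I, [/\ sigma = code a, forall i, a i \eps sX &
    forall i j, near (a i) (a j)].

Definition microchain (p : nat) (c : I) : Prop :=
  exists n g sigma : I, [/\ is_nat n, is_fun g n G,
    is_fun sigma n (epow sX p.+1),
    forall i, i \eps n -> microsimplex p (app sigma i) &
    formal_sum sX G plus p n g sigma c].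

Definition cycle (p : nat) (c : I) : Prop :=
  microchain p c /\
  (if p is q.+1 then bd sX G plus q c = czero sX G plus q else True).

Definition boundary (p : nat) (b : I) : Prop :=
  exists d, microchain p.+1 d /\ b = bd sX G plus p d.

(* The quotient group cycles / boundaries: its elements are the cosets, and
   its operation is the addition of cosets. *)
Definition homology (p : nat) : set (set I) :=
  [set S | exists z, cycle p z /\
    S = [set c | exists b, boundary p b /\ c = cadd sX plus p z b]].
Definition homology_add (p : nat) (S T : set I) : set I :=
  [set c | exists s t, [/\ S s, T t & c = cadd sX plus p s t]].

End MuHomology.

Definition group_isomorphic (T T' : Type) (H : set T) (op : T -> T -> T)
    (H' : set T') (op' : T' -> T' -> T') : Prop :=
  exists phi : T -> T', set_bij H H' phi /\
    forall x y, H x -> H y -> phi (op x y) = op' (phi x) (phi y).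

(* Main.v *)
From HB Require Import structures.
From mathcomp Require Import all_boot ssralg.
From mathcomp Require Import boolp classical_sets functions.
Require Import Defs.

(** By saturation there is an internal retraction r of *X onto *A that moves
    every point by an infinitesimal: every entourage admits such a map in the
    standard universe, by density and choice.  The chain maps induced by r and by
    the inclusion i preserve microchains; r i is the identity and i r is chain
    homotopic to the identity through the prism operator, which again preserves
    microchains because x is infinitely close to r x.

    Internal homomorphisms on hyperfinite chains are built from their values on
    the one-term chains by internal (Kuratowski) induction on finite supports,
    and microchains are recognised as the internal chains whose support consists
    of microsimplices.  Internality itself is expressed by types with a code in
    the structure and closed under a small calculus of definability. *)

Set Implicit Arguments.
Unset Strict Implicit.
Unset Printing Implicit Defensive.
Local Open Scope classical_set_scope.

(** * Definability with parameters *)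

(** The set of microsimplices is external, so no internal induction can run over it. Homomorphisms
    are therefore built on the full internal chain groups, and microchains enter through supports:
    the support of one given chain is internal even when the condition imposed on its simplices is
    not.

    Saturation gives one r for all entourages because the entourages are elements of the standard
    universe and finitely many of them contain a common one. The map r is asked to fix *A pointwise,
    which is consistent with any entourage since a point of A approximates itself; this makes r i
    the identity on chains, so that a homotopy is called for on one side alone. That r preserves
    microsimplices is the chain r x ≈ x ≈ y ≈ r y.

    The universes are arbitrary models of Zermelo set theory with choice. Hence each set must be cut
    out of a known set by a formula, and each use of induction or separation comes with a proof that
    the predicate is definable; the tactics [dfn] and [int] produce these proofs. *)

Definition shift (T : Type) (e : nat -> T) (n : nat) : T := e n.+1.

Definition up (rho : nat -> nat) (n : nat) : nat :=
  if n is m.+1 then (rho m).+1 else 0.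

Fixpoint ren (rho : nat -> nat) (phi : form) : form :=
  match phi with
  | fMem i k => fMem (rho i) (rho k)
  | fEq i k => fEq (rho i) (rho k)
  | fBot => fBot
  | fImp phi1 phi2 => fImp (ren rho phi1) (ren rho phi2)
  | fAll psi => fAll (ren (up rho) psi)
  end.

Lemma scons_shift (T : Type) (e : nat -> T) : scons (e 0) (shift e) = e.
Proof. by apply/funext; case. Qed.

Lemma sat_ren (K : eps_structure) phi (e : nat -> K) rho :
  sat e (ren rho phi) <-> sat (e \o rho) phi.
Proof.
elim: phi e rho => //= [phi1 IH1 phi2 IH2|psi IH] e rho.
  by rewrite IH1 IH2.
suff E x : scons x e \o up rho = scons x (e \o rho).
  by split=> H x; have := H x; rewrite IH E.
by apply/funext; case.
Qed.

(** A formula mentions finitely many variables. This is what allows an instance of separation, whose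
    environment is infinite, to be closed into a single sentence. *)
Lemma sat_bounded phi : exists k, forall (K : eps_structure) (e e' : nat -> K),
  (forall n, n < k -> e n = e' n) -> (sat e phi <-> sat e' phi).
Proof.
elim: phi => [i l|i l||phi1 [k1 IH1] phi2 [k2 IH2]|psi [k IH]].
- exists (maxn i l).+1 => K e e' H /=.
  by rewrite !H // ltnS ?leq_maxl ?leq_maxr.
- exists (maxn i l).+1 => K e e' H /=.
  by rewrite !H // ltnS ?leq_maxl ?leq_maxr.
- by exists 0.
- exists (maxn k1 k2) => K e e' H /=.
  have H1 : sat e phi1 <-> sat e' phi1.
    by apply: IH1 => n ln; apply: H; rewrite leq_max ln.
  have H2 : sat e phi2 <-> sat e' phi2.
    by apply: IH2 => n ln; apply: H; rewrite leq_max ln orbT.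
  by rewrite H1 H2.
- exists k => K e e' H /=.
  have H' x : sat (scons x e) psi <-> sat (scons x e') psi.
    by apply: IH => -[//|n] ln /=; apply: H; exact: ltnW.
  by split=> H1 x; apply/H'.
Qed.

Section Definability.
Variables (M N : eps_structure) (j : M -> N).
Implicit Types (P : (nat -> M) -> Prop) (Q : (nat -> N) -> Prop).

Definition penv (K : eps_structure) (h : M -> K) (a : nat -> nat + M)
    (e : nat -> K) (n : nat) : K :=
  match a n with inl k => e k | inr m => h m end.

(* P and Q are defined by one and the same formula, with parameters m in M
   that Q reads as j m. *)
Definition dfn2 P Q : Prop :=
  exists phi a, (forall e, P e <-> sat (penv id a e) phi) /\
                (forall e, Q e <-> sat (penv j a e) phi).

(** The language has no function symbols, so a term is represented by its graph, with the value in
    variable 0 and the arguments shifted by one. *)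
Definition dterm2 t t' : Prop :=
  dfn2 (fun e => e 0 = t (shift e)) (fun e => e 0 = t' (shift e)).

Lemma dfn2_transfer P Q : elementary j -> dfn2 P Q ->
  forall e, P e <-> Q (j \o e).
Proof.
move=> hj [phi [a [HP HQ]]] e; rewrite HP HQ hj.
suff -> : j \o penv id a e = penv j a (j \o e) by [].
by apply/funext => n; rewrite /penv /=; case: (a n).
Qed.

Lemma dfn2_ext P Q P' Q' : (forall e, P e <-> P' e) ->
  (forall e, Q e <-> Q' e) -> dfn2 P' Q' -> dfn2 P Q.
Proof.
move=> HP HQ [phi [a [HP' HQ']]]; exists phi, a.
by split=> e; rewrite ?HP ?HQ.
Qed.

Lemma dfn2_bot : dfn2 (fun=> False) (fun=> False).
Proof. by exists fBot, inl. Qed.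

Lemma dfn2_imp P Q P' Q' : dfn2 P Q -> dfn2 P' Q' ->
  dfn2 (fun e => P e -> P' e) (fun e => Q e -> Q' e).
Proof.
move=> [phi [a [HP HQ]]] [phi' [a' [HP' HQ']]].
(* The two formulas come with separate parameter assignments; moving their variables to the even and
   to the odd indices lets one assignment carry both. *)
pose b n := if odd n then a' n./2 else a n./2.
exists (fImp (ren double phi) (ren (fun n => n.*2.+1) phi')), b.
have E1 (K : eps_structure) (h : M -> K) (e : nat -> K) :
    penv h b e \o double = penv h a e.
  by apply/funext => n; rewrite /penv /= /b odd_double doubleK.
have E2 (K : eps_structure) (h : M -> K) (e : nat -> K) :
    penv h b e \o (fun n => n.*2.+1) = penv h a' e.
  by apply/funext => n; rewrite /penv /= /b /= odd_double uphalf_double.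
by split=> e /=; rewrite !sat_ren E1 E2 ?HP ?HP' ?HQ ?HQ'.
Qed.

Lemma dfn2_all (P : M -> (nat -> M) -> Prop) (Q : N -> (nat -> N) -> Prop) :
  dfn2 (fun e => P (e 0) (shift e)) (fun e => Q (e 0) (shift e)) ->
  dfn2 (fun e => forall x, P x e) (fun e => forall x, Q x e).
Proof.
move=> [phi [a [HP HQ]]].
(* Several variables of the formula may stand for [e 0]. All of them become the bound variable 0 and
   the others move past it, so the value of [b] where [a n] is [inl 0] is never read. *)
pose rho n := if a n is inl 0 then 0 else n.+1.
pose b n := match a n with inl k => inl k.-1 | inr m => inr m end.
exists (fAll (ren rho phi)), b.
have E (K : eps_structure) (h : M -> K) (e : nat -> K) x :
    scons x (penv h b e) \o rho = penv h a (scons x e).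
  apply/funext => n; rewrite /penv /rho /b /=.
  by case En: (a n) => [[|k]|m] //=; rewrite En.
by split=> e /=; split=> H x; have := H x; rewrite sat_ren E -(HP, HQ).
Qed.

Lemma dfn2_ren P Q rho :
  dfn2 P Q -> dfn2 (fun e => P (e \o rho)) (fun e => Q (e \o rho)).
Proof.
move=> [phi [a [HP HQ]]].
pose b n := match a n with inl k => inl (rho k) | inr m => inr m end.
have E (K : eps_structure) (h : M -> K) (e : nat -> K) :
    penv h a (e \o rho) = penv h b e.
  by apply/funext => n; rewrite /penv /b; case: (a n).
by exists phi, b; split=> e; rewrite ?HP ?HQ E.
Qed.

Lemma dfn2_sat phi : dfn2 (fun e => sat e phi) (fun e => sat e phi).
Proof. by exists phi, inl. Qed.

Lemma dfn2_not P Q : dfn2 P Q -> dfn2 (fun e => ~ P e) (fun e => ~ Q e).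
Proof. by move=> H; apply: dfn2_imp => //; exact: dfn2_bot. Qed.

Lemma dfn2_or P Q P' Q' : dfn2 P Q -> dfn2 P' Q' ->
  dfn2 (fun e => P e \/ P' e) (fun e => Q e \/ Q' e).
Proof.
move=> H H'; apply: (dfn2_ext _ _ (dfn2_imp (dfn2_not H) H')) => e;
  [have := EM (P e)|have := EM (Q e)]; tauto.
Qed.

Lemma dfn2_and P Q P' Q' : dfn2 P Q -> dfn2 P' Q' ->
  dfn2 (fun e => P e /\ P' e) (fun e => Q e /\ Q' e).
Proof.
move=> H H'; apply: (dfn2_ext _ _ (dfn2_not (dfn2_imp H (dfn2_not H')))) => e;
  (split=> [|H0]; [tauto|by split; apply: contrapT; tauto]).
Qed.

Lemma dfn2_iff P Q P' Q' : dfn2 P Q -> dfn2 P' Q' ->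
  dfn2 (fun e => P e <-> P' e) (fun e => Q e <-> Q' e).
Proof. by move=> H H'; apply: dfn2_and; apply: dfn2_imp. Qed.

Lemma dfn2_ex (P : M -> (nat -> M) -> Prop) (Q : N -> (nat -> N) -> Prop) :
  dfn2 (fun e => P (e 0) (shift e)) (fun e => Q (e 0) (shift e)) ->
  dfn2 (fun e => exists x, P x e) (fun e => exists x, Q x e).
Proof.
move=> H.
apply: (@dfn2_ext _ _ (fun e => ~ forall x, ~ P x e) (fun e => ~ forall x, ~ Q x e)).
- by move=> e; split=> [[x Px] /(_ x)|H0] //; apply: contrapT => /forallNP.
- by move=> e; split=> [[x Px] /(_ x)|H0] //; apply: contrapT => /forallNP.
by apply: dfn2_not; apply: dfn2_all; apply: dfn2_not.
Qed.

Lemma dterm2_var k : dterm2 (fun e => e k) (fun e => e k).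
Proof. by exists (fEq 0 1), (fun n => if n is 0 then inl 0 else inl k.+1). Qed.

Lemma dterm2_cst m : dterm2 (fun=> m) (fun=> j m).
Proof. by exists (fEq 0 1), (fun n => if n is 0 then inl 0 else inr m). Qed.

Lemma dfn2_subst t t' (P : M -> (nat -> M) -> Prop) (Q : N -> (nat -> N) -> Prop) :
  dterm2 t t' ->
  dfn2 (fun e => P (e 0) (shift e)) (fun e => Q (e 0) (shift e)) ->
  dfn2 (fun e => P (t e) e) (fun e => Q (t' e) e).
Proof.
move=> Ht HP.
apply: (@dfn2_ext _ _ (fun e => forall x, x = t e -> P x e)
                     (fun e => forall x, x = t' e -> Q x e)).
- by move=> e; split=> [H x ->//|]; apply.
- by move=> e; split=> [H x ->//|]; apply.
by apply: dfn2_all; apply: dfn2_imp.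
Qed.

Lemma dterm2_shift t t' : dterm2 t t' ->
  dterm2 (fun e => t (shift e)) (fun e => t' (shift e)).
Proof.
exact: (@dfn2_ren _ _ (fun n => if n is m.+1 then m.+2 else 0)).
Qed.

Lemma dfn2_subst2 t t' u u' (P : M -> M -> Prop) (Q : N -> N -> Prop) :
  dterm2 t t' -> dterm2 u u' ->
  dfn2 (fun e => P (e 0) (e 1)) (fun e => Q (e 0) (e 1)) ->
  dfn2 (fun e => P (t e) (u e)) (fun e => Q (t' e) (u' e)).
Proof.
move=> Ht Hu H.
apply: (dfn2_subst (P := fun x e => P x (u e)) (Q := fun x e => Q x (u' e)) Ht).
apply: (dfn2_subst (P := fun y e => P (e 0) y) (Q := fun y e => Q (e 0) y)
  (dterm2_shift Hu)).
by apply: (dfn2_ren (fun n => if n is 0 then 1 else 0) H).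
Qed.

Lemma dfn2_mem t t' u u' : dterm2 t t' -> dterm2 u u' ->
  dfn2 (fun e => t e \eps u e) (fun e => t' e \eps u' e).
Proof.
move=> Ht Hu; apply: (dfn2_subst2 (P := @eps M) (Q := @eps N)) => //.
by exists (fMem 0 1), inl.
Qed.

Lemma dfn2_eq t t' u u' : dterm2 t t' -> dterm2 u u' ->
  dfn2 (fun e => t e = u e) (fun e => t' e = u' e).
Proof.
move=> Ht Hu; apply: (dfn2_subst2 (P := @eq M) (Q := @eq N)) => //.
by exists (fEq 0 1), inl.
Qed.

Lemma dterm2_fun2 t t' u u' (F : M -> M -> M) (F' : N -> N -> N) :
  dterm2 t t' -> dterm2 u u' ->
  dfn2 (fun e => e 0 = F (e 1) (e 2)) (fun e => e 0 = F' (e 1) (e 2)) ->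
  dterm2 (fun e => F (t e) (u e)) (fun e => F' (t' e) (u' e)).
Proof.
move=> Ht Hu H; rewrite /dterm2.
apply: (dfn2_subst (P := fun x e => e 0 = F x (u (shift e)))
  (Q := fun x e => e 0 = F' x (u' (shift e))) (dterm2_shift Ht)).
apply: (dfn2_subst (P := fun x e => e 1 = F (e 0) x)
  (Q := fun x e => e 1 = F' (e 0) x) (dterm2_shift (dterm2_shift Hu))).
exact: (dfn2_ren (fun n => match n with 0 => 2 | 1 => 1 | _ => 0 end) H).
Qed.

End Definability.

(** Definability is proved by descending through the syntax of the predicate. The bare version knows
    no pairs: these are definable only once the axioms hold in both structures, and it serves to
    transfer the axioms themselves. *)
Ltac dfn_bare_step := first
  [ refine (dterm2_var _ _) | refine (dterm2_cst _ _)
  | refine (dfn2_bot _) | refine (dfn2_and _ _) | refine (dfn2_or _ _)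
  | refine (dfn2_iff _ _) | refine (dfn2_ex _) | refine (dfn2_all _)
  | refine (dfn2_not _)
  | refine (dfn2_imp _ _) | refine (dfn2_mem _ _) | refine (dfn2_eq _ _) ].
Ltac dfn_bare := repeat (dfn_bare_step; rewrite /shift /=).

(** * Transfer of sentences and of the separation schema *)

Section Transfer.
Variables (M N : eps_structure) (j : M -> N).
Hypotheses (hM : ZC M) (hj : elementary j).

Lemma sentence_transfer (P Q : Prop) :
  dfn2 j (fun=> P) (fun=> Q) -> P -> Q.
Proof. by move=> H; have [] := dfn2_transfer hj H (fun=> point). Qed.

Fixpoint allk (K : Type) k (P : (nat -> K) -> Prop) (e : nat -> K) : Prop :=
  if k is k'.+1 then forall x, allk k' P (scons x e) else P e.

Lemma dfn2_allk k P Q : dfn2 j P Q -> dfn2 j (allk k P) (allk k Q).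
Proof.
move=> H; elim: k => //= k IH.
apply: (dfn2_all (P := fun x e => allk k P (scons x e))
  (Q := fun x e => allk k Q (scons x e))).
by apply: (dfn2_ext _ _ IH) => e; rewrite scons_shift.
Qed.

Lemma allkP (K : Type) k P (e e0 : nat -> K) : allk k P e0 ->
  P (fun n => if n < k then e n else e0 (n - k)).
Proof.
elim: k e0 => /= [|k IH] e0 H.
  by congr (P _): H; apply/funext => n; rewrite subn0.
(* Each inner quantifier pushes the earlier values up by one index, so the outermost one ends at
   index [k]. *)
have := IH _ (H (e k)); congr (P _); apply/funext => n.
rewrite ltnS; case: ltngtP => [//|lt_kn|->]; last by rewrite subnn.
by rewrite -(subnSK lt_kn).
Qed.

(* Separation is a schema: for each phi, quantify over the finitely many
   parameters that phi mentions and transfer the resulting sentence. *)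
Lemma separation_transfer (phi : form) (e : nat -> N) (x : N) : exists s,
  forall z, z \eps s <-> z \eps x /\ sat (scons z e) phi.
Proof.
have [k Hk] := sat_bounded phi.
(* The set to separate from becomes variable 0 and the parameters follow it, hence the [k.+1]
   quantifiers below. *)
pose S (K : eps_structure) (E : nat -> K) := exists s, forall z,
  z \eps s <-> z \eps E 0 /\ sat (scons z (shift E)) phi.
have HS : dfn2 j (@S M) (@S N).
  apply: dfn2_ex; apply: dfn2_all; rewrite /shift /=.
  apply: dfn2_iff; first by dfn_bare.
  apply: dfn2_and; first by dfn_bare.
  pose rho n := if n is m.+1 then m.+3 else 0.
  have E (K : eps_structure) (e' : nat -> K) :
      scons (e' 0) (fun n => e' n.+3) = e' \o rho by apply/funext; case.
  apply: dfn2_ext (dfn2_ren rho (dfn2_sat j phi)) => e';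
    by rewrite -E.
have HM : forall E, allk k.+1 (@S M) E.
  elim: (k.+1) => [E|k' IH E] /=; last by move=> z; exact: IH.
  exact: (zc_separation hM).
have /(allkP (scons x e)) :=
  (dfn2_transfer hj (dfn2_allk k.+1 HS) (fun=> point)).1 (HM _).
move=> [s Hs]; exists s => z.
have E : sat (scons z (shift (fun n => if n < k.+1 then scons x e n else j point)))
    phi <-> sat (scons z e) phi.
  apply: Hk => -[//|n] lt_nk /=; rewrite /shift /=.
  by rewrite ltnS (ltnW lt_nk).
split=> [/(Hs z).1[zx H]|[zx H]]; first by split=> //; exact: E.1 H.
by apply: (Hs z).2; split=> //; exact: E.2 H.
Qed.

End Transfer.

(** * Set theory inside a structure *)

Notation dfn P := (dfn2 id P P).

Lemma in_setof (M : eps_structure) (P : set M) :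
  (exists s, forall z, z \eps s <-> P z) -> forall z, z \eps setof P <-> P z.
Proof. exact: getPex. Qed.

Section BasicSets.
Variable M : eps_structure.
Hypotheses
  (hext : forall x y : M, (forall z, z \eps x <-> z \eps y) -> x = y)
  (hpair : forall x y : M, exists s, forall z, z \eps s <-> z = x \/ z = y)
  (hunion : forall x : M, exists s, forall z,
    z \eps s <-> exists y, y \eps x /\ z \eps y)
  (hsep : forall (phi : form) (e : nat -> M) (x : M), exists s,
    forall z, z \eps s <-> z \eps x /\ sat (scons z e) phi).

Lemma in_eempty0 (z : M) : ~ z \eps eempty.
Proof.
suff H : forall z : M, z \eps eempty <-> set0 z by move/H.
apply: in_setof; have [s Hs] := hsep fBot (fun=> point) (point : M).
by exists s => y; rewrite Hs; split=> [[]|].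
Qed.

Lemma in_esucc0 (n z : M) : z \eps esucc n <-> z \eps n \/ z = n.
Proof.
move: z; apply: in_setof.
have [u Hu] := hpair n n; have [v Hv] := hpair n u; have [s Hs] := hunion v.
exists s => z; rewrite Hs; split.
  move=> [y [/Hv[->|->]]]; first by left.
  by move=> /Hu[] ->; right.
case=> [zn|->]; first by exists n; split=> //; apply/Hv; left.
by exists u; split; [apply/Hv; right|apply/Hu; left].
Qed.

(** [inductive] mentions [eempty] and [esucc], which are picked by [get]; the right-hand side has
    membership and equality alone and can be transferred. The section assumes the axioms one by one
    so that this applies to a structure not yet known to satisfy [ZC]. *)
Lemma inductiveE0 (w : M) : inductive w <->
  (forall z, (forall u, ~ u \eps z) -> z \eps w) /\
  (forall n z, n \eps w -> (forall u, u \eps z <-> u \eps n \/ u = n) -> z \eps w).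
Proof.
split=> [[w0 wS]|[w0 wS]]; split.
- move=> z Hz; suff -> : z = eempty by [].
  by apply: hext => u; split=> [/Hz|/in_eempty0].
- move=> n z nw Hz; suff -> : z = esucc n by exact: wS.
  by apply: hext => u; rewrite Hz in_esucc0.
- by apply: w0 => u /in_eempty0.
- by move=> n nw; apply: (wS n) => // u; rewrite in_esucc0.
Qed.

End BasicSets.

(** The axioms are single sentences except for separation, which is a schema, and infinity, which
    must first be rid of its defined terms. *)
Lemma ZC_transfer (M N : eps_structure) (j : M -> N) :
  ZC M -> elementary j -> ZC N.
Proof.
move=> hM hj.
have next : forall x y : N, (forall z, z \eps x <-> z \eps y) -> x = y.
  by apply: (sentence_transfer hj _ (zc_ext hM)); dfn_bare.
have npair : forall x y : N, exists s, forall z, z \eps s <-> z = x \/ z = y.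
  by apply: (sentence_transfer hj _ (zc_pairing hM)); dfn_bare.
have nunion : forall x : N, exists s, forall z,
    z \eps s <-> exists y, y \eps x /\ z \eps y.
  by apply: (sentence_transfer hj _ (zc_union hM)); dfn_bare.
have nsep := separation_transfer hM hj.
split=> //.
- by apply: (sentence_transfer hj _ (zc_power hM)); rewrite /esub; dfn_bare.
- have HM : exists w : M,
      (forall z, (forall u, ~ u \eps z) -> z \eps w) /\
      (forall n z, n \eps w -> (forall u, u \eps z <-> u \eps n \/ u = n) ->
         z \eps w).
    have [w Hw] := zc_infinity hM; exists w; apply/inductiveE0 => //;
      by case: hM.
  have [w Hw] : exists w : N,
      (forall z, (forall u, ~ u \eps z) -> z \eps w) /\
      (forall n z, n \eps w -> (forall u, u \eps z <-> u \eps n \/ u = n) ->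
         z \eps w).
    by apply: (sentence_transfer hj _ HM); dfn_bare.
  by exists w; apply/inductiveE0.
- by apply: (sentence_transfer hj _ (zc_choice hM)); rewrite /unique; dfn_bare.
Qed.

Section Sets.
Variable M : eps_structure.
Hypothesis hM : ZC M.
Implicit Types (x y z A B w : M).

Lemma ext x y : (forall z, z \eps x <-> z \eps y) -> x = y.
Proof. exact: (zc_ext hM). Qed.

Lemma in_eempty z : ~ z \eps eempty.
Proof. exact: in_eempty0 (zc_separation hM) z. Qed.

Lemma in_esucc (n z : M) : z \eps esucc n <-> z \eps n \/ z = n.
Proof. exact: in_esucc0 (zc_pairing hM) (zc_union hM) n z. Qed.

Lemma in_eupair x y z : z \eps eupair x y <-> z = x \/ z = y.
Proof. exact: (in_setof (zc_pairing hM x y)). Qed.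

Lemma eupair1P x y z : eupair x y = eupair z z -> x = z /\ y = z.
Proof.
move=> E; have [/in_eupair[]? /in_eupair[]?] //: x \eps eupair z z /\ y \eps eupair z z.
by rewrite -E; split; apply/in_eupair; [left|right].
Qed.

Lemma opair_inj x y x' y' : opair x y = opair x' y' -> x = x' /\ y = y'.
Proof.
move=> E.
have H1 : eupair x x \eps opair x' y' by rewrite -E; apply/in_eupair; left.
have xx' : x = x'.
  by move/in_eupair: H1 => [/eupair1P[]|/esym/eupair1P[]].
subst x'; split=> //.
have H2 : eupair x y \eps opair x y' by rewrite -E; apply/in_eupair; right.
have H3 : eupair x y' \eps opair x y by rewrite E; apply/in_eupair; right.
move/in_eupair: H2 => [/eupair1P[_ yx]|E2].
  by move/in_eupair: H3; rewrite yx => -[]/eupair1P[].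
have : y \eps eupair x y' by rewrite -E2; apply/in_eupair; right.
move/in_eupair => [yx|//].
by move: E2; rewrite yx => /esym/eupair1P[].
Qed.

Lemma dfn_separation (P : M -> Prop) : dfn (fun e => P (e 0)) ->
  forall x, exists s, forall z, z \eps s <-> z \eps x /\ P z.
Proof.
move=> [phi [a [HP _]]] x.
pose rho n := if a n is inl 0 then 0 else n.+1.
(* [P] depends on variable 0 alone, so the remaining free variables may take any value. *)
pose e0 : nat -> M := fun=> point.
pose e' n := match a n with inl k => e0 k.-1 | inr m => m end.
have [s Hs] := zc_separation hM (ren rho phi) e' x.
exists s => z; rewrite Hs sat_ren.
suff -> : scons z e' \o rho = penv id a (scons z e0) by rewrite -HP.
apply/funext => n; rewrite /penv /rho /e' /=.
by case En: (a n) => [[|k]|m] //=; rewrite En.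
Qed.

End Sets.

Section SetTerms.
Variables (M N : eps_structure) (j : M -> N).
Hypotheses (hM : ZC M) (hN : ZC N).

Lemma dterm2_eupair t t' u u' : dterm2 j t t' -> dterm2 j u u' ->
  dterm2 j (fun e => eupair (t e) (u e)) (fun e => eupair (t' e) (u' e)).
Proof.
move=> Ht Hu; apply: dterm2_fun2 => //.
apply: (@dfn2_ext _ _ _ _ _
  (fun e => forall z, z \eps e 0 <-> z = e 1 \/ z = e 2)
  (fun e => forall z, z \eps e 0 <-> z = e 1 \/ z = e 2)); last by dfn_bare.
- move=> e; split=> [-> z|H]; first exact: in_eupair.
  by apply: ext => // z; rewrite H in_eupair.
- move=> e; split=> [-> z|H]; first exact: in_eupair.
  by apply: ext => // z; rewrite H in_eupair.
Qed.

Lemma dterm2_opair t t' u u' : dterm2 j t t' -> dterm2 j u u' ->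
  dterm2 j (fun e => opair (t e) (u e)) (fun e => opair (t' e) (u' e)).
Proof. by move=> Ht Hu; rewrite /opair; do !apply: dterm2_eupair. Qed.

End SetTerms.

Ltac dfn hM hN :=
  repeat (first [refine (dterm2_opair hM hN _ _) | dfn_bare_step]; rewrite /shift /=).

Section MoreSets.
Variable M : eps_structure.
Hypothesis hM : ZC M.
Implicit Types (x y z A B w : M).

Definition epower A : M := setof [set z | esub z A].
Definition omega : M := setof [set n : M | is_nat n].

Lemma in_epower A z : z \eps epower A <-> esub z A.
Proof. exact: (in_setof (zc_power hM A)). Qed.

Lemma in_eprod A B z :
  z \eps eprod A B <-> exists x y, [/\ x \eps A, y \eps B & z = opair x y].
Proof.
move: z; apply: in_setof.
have [u Hu] := zc_pairing hM A B; have [v Hv] := zc_union hM u.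
(* A Kuratowski pair of elements of the union [v] of [A] and [B] lies in the double power set of
   [v]. *)
have [s Hs] : exists s, forall z, z \eps s <-> z \eps epower (epower v) /\
    exists x y, x \eps A /\ y \eps B /\ z = opair x y.
  by apply: dfn_separation => //; dfn hM hM.
exists s => z; rewrite Hs; split=> [[_ [x [y [xA [yB ->]]]]]|[x [y [xA yB ->]]]].
  by exists x, y.
have xv : x \eps v by apply/Hv; exists A; split=> //; apply/Hu; left.
have yv : y \eps v by apply/Hv; exists B; split=> //; apply/Hu; right.
split; last by exists x, y.
apply/in_epower => t /(in_eupair hM) tE; apply/in_epower => q.
by case: tE => -> /(in_eupair hM)[]->.
Qed.

Lemma in_eprod_pair A B x y : opair x y \eps eprod A B <-> x \eps A /\ y \eps B.
Proof.
rewrite in_eprod; split=> [[x' [y' [? ? /(opair_inj hM)[-> ->]]]]//|[? ?]].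
by exists x, y.
Qed.

Lemma in_omega (n : M) : n \eps omega <-> is_nat n.
Proof.
move: n; apply: in_setof; have [w Hw] := zc_infinity hM.
have [s Hs] : exists s, forall z, z \eps s <-> z \eps w /\ forall w,
  (forall z, (forall u, ~ u \eps z) -> z \eps w) /\
  (forall n z, n \eps w -> (forall u, u \eps z <-> u \eps n \/ u = n) -> z \eps w)
    -> z \eps w.
  by apply: dfn_separation => //; dfn hM hM.
have E := inductiveE0 (zc_ext hM) (zc_pairing hM) (zc_union hM) (zc_separation hM).
exists s => n; rewrite Hs; split=> [[_ H] v /E|H]; first exact: H.
by split=> [|v /E Hv]; exact: H.
Qed.

Lemma omega_inductive : inductive omega.
Proof.
split=> [|n /in_omega Hn]; apply/in_omega => w Hw; first exact: Hw.1.
by apply: Hw.2; exact: Hn.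
Qed.

End MoreSets.

(** * Internal types, predicates and maps *)

Existing Class ZC.
#[local] Obligation Tactic := idtac.

(* T is identified by [enc] with the set [ran T] of M; a predicate or a map on
   such types is internal if M has the corresponding set. *)
Class IT (M : eps_structure) (T : Type) := {
  enc : T -> M;
  ran : M;
  enc_inj : injective enc;
  ranP : forall x, x \eps ran <-> exists t, enc t = x }.
Arguments ran {M} T {_}.
Arguments enc_inj {M T _ x1 x2} _.

#[global] Hint Mode IT - ! : typeclass_instances.

Section Internal.
Context {M : eps_structure} {hM : ZC M}.

Definition internal (T : Type) {iT : IT M T} (P : T -> Prop) : Prop :=
  exists B : M, forall t, P t <-> enc t \eps B.

Definition iterm (T T' : Type) {iT : IT M T} {iT' : IT M (T * T')}
  (f : T -> T') : Prop := internal (fun p : T * T' => p.2 = f p.1).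

Lemma enc_ran T {iT : IT M T} (t : T) : enc t \eps ran T.
Proof. by apply/ranP; exists t. Qed.

Lemma enc_injE T {iT : IT M T} (t u : T) : enc t = enc u <-> t = u.
Proof. by split=> [/enc_inj|->]. Qed.

Lemma ran_all T {iT : IT M T} (Q : M -> Prop) :
  (forall y, y \eps ran T -> Q y) <-> (forall t : T, Q (enc t)).
Proof.
split=> [H t|H y /ranP[t <-]//].
by apply: H; exact: enc_ran.
Qed.

Lemma ran_ex T {iT : IT M T} (Q : M -> Prop) :
  (exists y, y \eps ran T /\ Q y) <-> (exists t : T, Q (enc t)).
Proof.
split=> [[y [/ranP[t <-]]]|[t Ht]]; first by exists t.
by exists (enc t); split=> //; exact: enc_ran.
Qed.

(** The bridge from definability to internality: [D] may have parameters in [M], and separation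
    inside [ran T] yields the set. The closure rules below come down to writing a predicate in terms
    of codes. *)
Lemma internal_dfn T {iT : IT M T} (D : M -> Prop) (P : T -> Prop) :
  dfn (fun e => D (e 0)) -> (forall t, P t <-> D (enc t)) -> internal P.
Proof.
move=> HD HP; have [B HB] := dfn_separation hM HD (ran T).
exists B => t; rewrite HB HP; split=> [|[]//].
by split=> //; exact: enc_ran.
Qed.

Program Instance IT_prod T T' {iT : IT M T} {iT' : IT M T'} : IT M (T * T') := {|
  enc := fun p => opair (enc p.1) (enc p.2);
  ran := eprod (ran T) (ran T') |}.
Next Obligation.
move=> T T' iT iT' [a b] [c d] /= /(opair_inj hM)[].
by move=> /enc_inj -> /enc_inj ->.
Qed.
Next Obligation.
move=> T T' iT iT' x; rewrite in_eprod; split.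
  move=> [y [z [/ranP[a <-] /ranP[b <-] ->]]].
  by exists (a, b).
move=> [[a b] <-]; exists (enc a), (enc b).
by split=> //; exact: enc_ran.
Qed.

Program Instance IT_unit : IT M unit := {|
  enc := fun=> eempty; ran := eupair eempty eempty |}.
Next Obligation. by move=> [] []. Qed.
Next Obligation.
move=> x; rewrite in_eupair; split=> [[]->|[_ <-]]; [by exists tt|by exists tt|by left].
Qed.

Record El (B : M) := MkEl { elv : M; elP : elv \eps B }.

Lemma elv_inj B : injective (@elv B).
Proof.
move=> [x xB] [y yB] /= E; subst y; congr MkEl; exact: Prop_irrelevance.
Qed.

Program Instance IT_El B : IT M (El B) := {| enc := @elv B; ran := B |}.
Next Obligation. exact: elv_inj. Qed.
Next Obligation.
by move=> B x; split=> [xB|[t <-]]; [exists (MkEl xB)|exact: elP].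
Qed.

Section Closure.
Context (T : Type) {iT : IT M T}.
Implicit Types (P Q : T -> Prop).

Lemma int_ext P Q : (forall t, P t <-> Q t) -> internal Q -> internal P.
Proof. by move=> H [B HB]; exists B => t; rewrite H. Qed.

(** [Q] may speak of external objects: since it does not vary with [t], the required set is
    everything or nothing. *)
Lemma int_cst (Q : Prop) : internal (fun _ : T => Q).
Proof.
have [q|q] := EM Q.
  by exists (ran T) => t; split=> // _; exact: enc_ran.
by exists eempty => t; split=> [/q//|/in_eempty].
Qed.

Lemma int_imp P Q : internal P -> internal Q -> internal (fun t => P t -> Q t).
Proof.
move=> [A HA] [B HB].
apply: (@internal_dfn _ _ (fun x => x \eps A -> x \eps B)); first by dfn hM hM.
by move=> t; rewrite HA HB.
Qed.

Lemma int_not P : internal P -> internal (fun t => ~ P t).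
Proof. by move=> H; apply: int_imp => //; exact: int_cst. Qed.

Lemma int_or P Q : internal P -> internal Q -> internal (fun t => P t \/ Q t).
Proof.
move=> HP HQ; apply: (int_ext _ (int_imp (int_not HP) HQ)) => t.
have := EM (P t); tauto.
Qed.

Lemma int_and P Q : internal P -> internal Q -> internal (fun t => P t /\ Q t).
Proof.
move=> HP HQ; apply: (int_ext _ (int_not (int_imp HP (int_not HQ)))) => t.
split=> [|H]; [tauto|by split; apply: contrapT; tauto].
Qed.

Lemma int_iff P Q : internal P -> internal Q -> internal (fun t => P t <-> Q t).
Proof. by move=> HP HQ; apply: int_and; exact: int_imp. Qed.

End Closure.

Section Quantifiers.
Context (T T' : Type) {iT : IT M T} {iT' : IT M T'}.

Lemma int_all (P : T -> T' -> Prop) :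
  internal (fun p => P p.1 p.2) -> internal (fun t => forall y, P t y).
Proof.
move=> [B HB].
apply: (@internal_dfn _ _ (fun x => forall y, y \eps ran T' -> opair x y \eps B)).
  by dfn hM hM.
move=> t; rewrite ran_all; split=> H y; first exact: (HB (t, y)).1 (H y).
exact: (HB (t, y)).2 (H y).
Qed.

Lemma int_ex (P : T -> T' -> Prop) :
  internal (fun p => P p.1 p.2) -> internal (fun t => exists y, P t y).
Proof.
move=> H; apply: (int_ext _ (int_not (int_all (P := fun t y => ~ P t y) (int_not H)))).
by move=> t; split=> [[y Py] /(_ y)|H0] //; apply: contrapT => /forallNP.
Qed.

Lemma iterm_id : iterm (fun t : T => t).
Proof.
apply: (@internal_dfn _ _ (fun x => exists y, x = opair y y)); first by dfn hM hM.
move=> [t u] /=; split=> [->|[y /(opair_inj hM)[<- /enc_inj]]//].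
by exists (enc t).
Qed.

Lemma iterm_fst : iterm (@fst T T').
Proof.
apply: (@internal_dfn _ _ (fun x => exists y z, x = opair (opair y z) y)).
  by dfn hM hM.
move=> [[t u] v] /=; split=> [->|[y [z /(opair_inj hM)[/(opair_inj hM)[<- _]]]]].
  by exists (enc t), (enc u).
by move=> /enc_inj.
Qed.

Lemma iterm_snd : iterm (@snd T T').
Proof.
apply: (@internal_dfn _ _ (fun x => exists y z, x = opair (opair y z) z)).
  by dfn hM hM.
move=> [[t u] v] /=; split=> [->|[y [z /(opair_inj hM)[/(opair_inj hM)[_ <-]]]]].
  by exists (enc t), (enc u).
by move=> /enc_inj.
Qed.

Lemma iterm_cst (c : T') : iterm (fun _ : T => c).
Proof.
apply: (@internal_dfn _ _ (fun x => exists y, x = opair y (enc c))).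
  by dfn hM hM.
move=> [t u] /=; split=> [->|[y /(opair_inj hM)[_ /enc_inj]]//].
by exists (enc t).
Qed.

Lemma int_comp (P : T' -> Prop) (f : T -> T') :
  internal P -> iterm f -> internal (fun t => P (f t)).
Proof.
move=> [B HB] [F HF].
apply: (@internal_dfn _ _ (fun x => exists y, y \eps ran T' /\
  (opair x y \eps F /\ y \eps B))); first by dfn hM hM.
move=> t; rewrite ran_ex; split=> [Pf|[y []]].
  exists (f t); split; last by apply/HB.
  exact: (HF (t, f t)).1.
by move=> /(HF (t, y)).2 /= -> /HB.
Qed.

Context (T'' : Type) {iT'' : IT M T''}.

Lemma iterm_pair (f : T -> T') (g : T -> T'') :
  iterm f -> iterm g -> iterm (fun t => (f t, g t)).
Proof.
move=> [F HF] [G HG].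
apply: (@internal_dfn _ _ (fun x => exists t a b, x = opair t (opair a b) /\
  (opair t a \eps F /\ opair t b \eps G))); first by dfn hM hM.
move=> [t [a b]] /=; split=> [[-> ->]|[t' [a' [b' []]]]].
  exists (enc t), (enc (f t)), (enc (g t)); split=> //.
  by split; [exact: (HF (t, f t)).1|exact: (HG (t, g t)).1].
move=> /(opair_inj hM)[<- /(opair_inj hM)[<- <-]] [].
by move=> /(HF (t, a)).2 /= -> /(HG (t, b)).2 /= ->.
Qed.

Lemma iterm_comp (g : T' -> T'') (f : T -> T') :
  iterm g -> iterm f -> iterm (fun t => g (f t)).
Proof.
move=> [G HG] [F HF].
apply: (@internal_dfn _ _ (fun x => exists t y z, y \eps ran T' /\ (x = opair t z /\
  (opair t y \eps F /\ opair y z \eps G)))); first by dfn hM hM.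
move=> [t z] /=; split=> [->|[t' [y' [z' [/ranP[y <-]]]]]].
  exists (enc t), (enc (f t)), (enc (g (f t))); split; first exact: enc_ran.
  by split=> //; split; [exact: (HF (t, f t)).1|exact: (HG (f t, g (f t))).1].
move=> [/(opair_inj hM)[<- <-]] [/(HF (t, y)).2 /= ->].
by move=> /(HG (f t, z)).2.
Qed.

End Quantifiers.

Lemma int_eq T T' {iT : IT M T} {iT' : IT M T'} (f g : T -> T') :
  iterm f -> iterm g -> internal (fun t => f t = g t).
Proof.
move=> Hf Hg.
apply: (int_comp (P := fun p : T' * T' => p.1 = p.2) (f := fun t => (f t, g t))).
  by apply: (int_ext _ (iterm_id (T := T'))) => p; split.
exact: iterm_pair.
Qed.

Lemma iterm_if T T' {iT : IT M T} {iT' : IT M T'} (P : T -> Prop) (f g : T -> T') :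
  internal P -> iterm f -> iterm g ->
  iterm (fun t => if `[< P t >] then f t else g t).
Proof.
move=> HP Hf Hg.
apply: (int_ext (Q := fun p => (P p.1 -> p.2 = f p.1) /\ (~ P p.1 -> p.2 = g p.1))).
  move=> [t y] /=; case: asboolP => H; tauto.
have H : internal (fun p : T * T' => P p.1) by apply: int_comp => //; exact: iterm_fst.
by apply: int_and; apply: int_imp => //; exact: int_not.
Qed.

(** Bundling a predicate or a map with its internality gives types that are coded in turn, by the
    internal power set and the internal function set. Internal predicates can thus quantify over
    subsets and maps. *)
Definition isub T {iT : IT M T} := {P : T -> Prop | internal P}.
Definition ifun T T' {iT : IT M T} {iT' : IT M T'} := {f : T -> T' | iterm f}.
Arguments isub T {iT}.
Arguments ifun T T' {iT iT'}.

Section Powers.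
Context (T : Type) {iT : IT M T}.

Definition isub_fun (W : isub T) : T -> Prop := sval W.
Coercion isub_fun : isub >-> Funclass.

Lemma isubP (W : isub T) : internal W.
Proof. exact: svalP. Qed.

Lemma isub_ext (W W' : isub T) : (forall t, W t <-> W' t) -> W = W'.
Proof.
case: W W' => [P HP] [Q HQ] /= H.
have E : P = Q by apply/funext => t; apply/propext; exact: H.
by subst Q; congr exist; exact: Prop_irrelevance.
Qed.

Definition esub_of (P : T -> Prop) : M := setof [set z | exists t, P t /\ z = enc t].

Lemma in_esub_of P : internal P ->
  forall z, z \eps esub_of P <-> exists t, P t /\ z = enc t.
Proof.
move=> [B HB]; apply: in_setof.
have [s Hs] : exists s, forall z, z \eps s <-> z \eps ran T /\ z \eps B.
  by apply: dfn_separation => //; dfn hM hM.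
exists s => z; rewrite Hs; split=> [[/ranP[t <-] /HB]|[t [/HB ? ->]]].
  by exists t.
by split=> //; exact: enc_ran.
Qed.

Lemma in_esub_of_enc P t : internal P -> enc t \eps esub_of P <-> P t.
Proof.
move=> HP; rewrite in_esub_of //; split=> [[u [Pu /enc_inj ->]]//|Pt].
by exists t.
Qed.

Program Instance IT_isub : IT M (isub T) := {|
  enc := fun W => esub_of W; ran := epower (ran T) |}.
Next Obligation.
move=> W W' /= E; apply: isub_ext => t.
by rewrite -(in_esub_of_enc t (isubP W)) E in_esub_of_enc //; exact: isubP.
Qed.
Next Obligation.
move=> x; rewrite in_epower; split=> [xT|[W <-] z].
  have HP : internal (fun t : T => enc t \eps x) by exists x.
  exists (exist _ _ HP); apply: ext => z; rewrite in_esub_of //; split.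
    by move=> [t [? ->]].
  by move=> zx; have /ranP[t Et] := xT _ zx; exists t; split=> //;
    rewrite /isub_fun /= Et.
by move=> /(in_esub_of (isubP W))[t [_ ->]]; exact: enc_ran.
Qed.

Lemma int_mem0 : internal (fun p : isub T * T => p.1 p.2).
Proof.
apply: (@internal_dfn _ _ (fun x => exists s t, x = opair s t /\ t \eps s)).
  by dfn hM hM.
move=> [W t]; rewrite /= -(in_esub_of_enc t (isubP W)); split=> [H|].
  by exists (esub_of W), (enc t).
by move=> [s [u [/(opair_inj hM)[-> ->]]]].
Qed.

Lemma int_mem U {iU : IT M U} (W : U -> isub T) (f : U -> T) :
  iterm W -> iterm f -> internal (fun u => W u (f u)).
Proof.
move=> HW Hf; apply: (int_comp (P := fun p : isub T * T => p.1 p.2)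
  (f := fun u => (W u, f u))); [exact: int_mem0|exact: iterm_pair].
Qed.

Context (T' : Type) {iT' : IT M T'}.

Definition ifun_fun (f : ifun T T') : T -> T' := sval f.
Coercion ifun_fun : ifun >-> Funclass.

Lemma ifunP (f : ifun T T') : iterm f.
Proof. exact: svalP. Qed.

Lemma ifun_ext (f g : ifun T T') : (forall t, f t = g t) -> f = g.
Proof.
case: f g => [f Hf] [g Hg] /= /funext E.
by subst g; congr exist; exact: Prop_irrelevance.
Qed.

End Powers.
Existing Instance IT_isub.

Lemma app_eq (F A B x y : M) : is_fun F A B -> x \eps A ->
  app F x = y <-> opair x y \eps F.
Proof.
move=> [_ FA] /FA [z [/= Fz zu]].
have Fg : opair x (app F x) \eps F.
  by apply: (getPex (P := [set y | opair x y \eps F])); exists z.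
by split=> [<- //|/zu <-]; rewrite -(zu _ Fg).
Qed.

Lemma app_in (F A B x : M) : is_fun F A B -> x \eps A -> app F x \eps B.
Proof.
move=> HF xA; have := (app_eq (app F x) HF xA).1 erefl.
by move=> /HF.1 /in_eprod_pair[].
Qed.

Lemma is_fun_ext (F F' A B : M) : is_fun F A B -> is_fun F' A B ->
  (forall x, x \eps A -> app F x = app F' x) -> F = F'.
Proof.
move=> HF HF' E; apply: ext => z.
have H (F1 F2 : M) : is_fun F1 A B -> is_fun F2 A B ->
    (forall x, x \eps A -> app F1 x = app F2 x) -> z \eps F1 -> z \eps F2.
  move=> H1 H2 E1 z1; have /in_eprod[x [y [xA yB zE]]] := H1.1 _ z1.
  by rewrite zE -(app_eq y H2) // -E1 // (app_eq y H1) // -zE.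
by split; apply: H => // x xA; rewrite E.
Qed.

Section Functions.
Context (T T' : Type) {iT : IT M T} {iT' : IT M T'}.

Definition graph (f : T -> T') : M := esub_of (fun p : T * T' => p.2 = f p.1).

Lemma in_graph f t y : iterm f -> opair (enc t) (enc y) \eps graph f <-> y = f t.
Proof. by move=> Hf; rewrite (in_esub_of_enc (t, y) Hf). Qed.

Lemma graph_fun f : iterm f -> is_fun (graph f) (ran T) (ran T').
Proof.
move=> Hf; split=> [z /(in_esub_of Hf)[p [_ ->]]|]; first exact: enc_ran.
apply/ran_all => t; exists (enc (f t)); split; first by apply/in_graph.
move=> y /(in_esub_of Hf)[[u v] /= [-> /(opair_inj hM)[/enc_inj <- ->]]] //.
Qed.

Lemma app_graph f t : iterm f -> app (graph f) (enc t) = enc (f t).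
Proof.
move=> Hf; apply/(app_eq _ (graph_fun Hf) (enc_ran t)).
by apply/in_graph.
Qed.

Lemma is_fun_ifun F : is_fun F (ran T) (ran T') ->
  exists f : ifun T T', graph f = F.
Proof.
move=> HF.
have ex (t : T) : exists y : T', enc y = app F (enc t).
  by apply/ranP; exact: app_in HF (enc_ran t).
have Hf : iterm (fun t => projT1 (cid (ex t))).
  exists F => -[t y] /=; rewrite -(app_eq _ HF (enc_ran t)).
  by case: cid => z /= <-; rewrite enc_injE; split.
exists (exist _ _ Hf); apply: (is_fun_ext (graph_fun Hf) HF).
by apply/ran_all => t; rewrite app_graph //=; case: cid.
Qed.

Program Instance IT_ifun : IT M (ifun T T') := {|
  enc := fun f => graph f;
  ran := setof [set F | is_fun F (ran T) (ran T')] |}.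
Next Obligation.
move=> f g /= E; apply: ifun_ext => t; apply: enc_inj.
by rewrite -(app_graph t (ifunP f)) E app_graph //; exact: ifunP.
Qed.
Next Obligation.
move=> F; rewrite in_setof.
  split=> [/is_fun_ifun //|[f <-]]; exact: graph_fun (ifunP f).
have [s Hs] : exists s, forall z, z \eps s <->
    z \eps epower (eprod (ran T) (ran T')) /\ forall x, x \eps ran T ->
    exists y, opair x y \eps z /\ forall y', opair x y' \eps z -> y = y'.
  by apply: dfn_separation => //; dfn hM hM.
by exists s => z; rewrite Hs in_epower.
Qed.

Lemma iterm_eval : iterm (fun p : ifun T T' * T => p.1 p.2).
Proof.
apply: (@internal_dfn _ _ (fun x => exists f t y, x = opair (opair f t) y /\
  opair t y \eps f)); first by dfn hM hM.
move=> [[f t] y] /=; rewrite -(in_graph _ _ (ifunP f)); split=> [H|].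
  by exists (graph f), (enc t), (enc y).
by move=> [? [? [? [/(opair_inj hM)[/(opair_inj hM)[-> ->] ->]]]]].
Qed.

Lemma iterm_app U {iU : IT M U} (F : U -> ifun T T') (f : U -> T) :
  iterm F -> iterm f -> iterm (fun u => F u (f u)).
Proof.
move=> HF Hf; apply: (iterm_comp (g := fun p : ifun T T' * T => p.1 p.2)
  (f := fun u => (F u, f u))); [exact: iterm_eval|exact: iterm_pair].
Qed.

End Functions.
Existing Instance IT_ifun.

Lemma iterm_comp2 U A B C {iU : IT M U} {iA : IT M A} {iB : IT M B} {iC : IT M C}
    (F : A -> B -> C) (f : U -> A) (g : U -> B) :
  iterm (fun p : A * B => F p.1 p.2) -> iterm f -> iterm g ->
  iterm (fun u => F (f u) (g u)).
Proof.
move=> HF Hf Hg.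
by apply: (iterm_comp (f := fun u => (f u, g u)) HF); exact: iterm_pair.
Qed.

Lemma int_comp2 U A B {iU : IT M U} {iA : IT M A} {iB : IT M B}
    (P : A -> B -> Prop) (f : U -> A) (g : U -> B) :
  internal (fun p : A * B => P p.1 p.2) -> iterm f -> iterm g ->
  internal (fun u => P (f u) (g u)).
Proof.
move=> HP Hf Hg.
by apply: (int_comp (f := fun u => (f u, g u)) HP); exact: iterm_pair.
Qed.

End Internal.
Existing Instances IT_prod IT_unit IT_El IT_isub IT_ifun.
Arguments isub {M} T {iT}.
Arguments ifun {M hM} T T' {iT iT'}.

(** The hook is redefined below as new internal operations become available to [int]. *)
Ltac int_hook := fail.
Ltac int_step := first [assumption | int_hook | refine (iterm_if _ _ _) |
  lazymatch goal with
  | |- iterm (@fst _ _) => exact: iterm_fst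
  | |- iterm (@snd _ _) => exact: iterm_snd
  | |- iterm (ifun_fun _) => exact: ifunP
  | |- internal (isub_fun _) => exact: isubP
  | |- iterm (fun x => x) => exact: iterm_id
  | |- iterm (fun _ => ?c) => exact: iterm_cst
  | |- iterm (fun x => (@?f x, @?g x)) =>
      refine (iterm_pair (f := f) (g := g) _ _)
  | |- iterm (fun x => fst (@?f x)) =>
      refine (iterm_comp (g := fst) (f := f) _ _); [exact: iterm_fst|]
  | |- iterm (fun x => snd (@?f x)) =>
      refine (iterm_comp (g := snd) (f := f) _ _); [exact: iterm_snd|]
  | |- iterm (fun x => ifun_fun (@?f x) (@?g x)) =>
      refine (iterm_app (F := f) (f := g) _ _)
  | |- internal (fun _ => ?Q) => exact: int_cst
  | |- internal (fun x => @?P x /\ @?Q x) => refine (int_and (P := P) (Q := Q) _ _)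
  | |- internal (fun x => @?P x \/ @?Q x) => refine (int_or (P := P) (Q := Q) _ _)
  | |- internal (fun x => @?P x <-> @?Q x) => refine (int_iff (P := P) (Q := Q) _ _)
  | |- internal (fun x => ~ @?P x) => refine (int_not (P := P) _)
  | |- internal (fun x => @?P x -> @?Q x) => refine (int_imp (P := P) (Q := Q) _ _)
  | |- internal (fun x => exists y, @?P x y) => refine (int_ex (P := P) _)
  | |- internal (fun x => forall y, @?P x y) => refine (int_all (P := P) _)
  | |- internal (fun x => isub_fun (@?W x) (@?f x)) =>
      refine (int_mem (W := W) (f := f) _ _)
  | |- internal (fun x => @?f x = @?g x) => refine (int_eq (f := f) (g := g) _ _)
  | |- iterm (fun x => ?g (@?f x)) =>
      match goal with H : iterm g |- _ => refine (iterm_comp (g := g) (f := f) H _) end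
  | |- internal (fun x => ?P (@?f x)) =>
      match goal with H : internal P |- _ => refine (int_comp (P := P) (f := f) H _) end
  end]; cbv beta.
Ltac int := repeat int_step.

(** * Internal natural numbers and finite sets *)

Section Naturals.
Context {M : eps_structure} {hM : ZC M}.

Definition NN : Type := El (omega M).

Definition zeroN : NN := MkEl (omega_inductive hM).1.
Definition succN (n : NN) : NN := MkEl ((omega_inductive hM).2 _ (elP n)).
Definition ltN (m n : NN) : Prop := elv m \eps elv n.

Lemma ltN0 m : ~ ltN m zeroN.
Proof. exact: in_eempty. Qed.

Lemma ltNS m n : ltN m (succN n) <-> ltN m n \/ m = n.
Proof. by rewrite /ltN in_esucc (enc_injE (iT := IT_El _)). Qed.

Lemma int_ltN : internal (fun p : NN * NN => ltN p.1 p.2).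
Proof.
apply: (@internal_dfn _ _ _ _ (fun x => exists a b, x = opair a b /\ a \eps b)).
  by dfn hM hM.
move=> [m n] /=; split=> [H|]; first by exists (elv m), (elv n).
by move=> [a [b [/(opair_inj hM)[<- <-]]]].
Qed.

(** Internality is essential: the extension of [P] has to be a set of [M] to count among the
    inductive sets over which [is_nat] quantifies. *)
Lemma NN_ind (P : NN -> Prop) : internal P -> P zeroN ->
  (forall n, P n -> P (succN n)) -> forall n, P n.
Proof.
move=> HP P0 PS n; rewrite -(in_esub_of_enc n HP).
apply: ((in_omega hM (elv n)).1 (elP n)); split.
  by apply/(in_esub_of HP); exists zeroN.
move=> _ /(in_esub_of HP)[m [Pm ->]]; apply/(in_esub_of HP).
by exists (succN m); split=> //; exact: PS.
Qed.

(** Transitivity of [omega]. The membership relation of [M] is an arbitrary relation, so this has to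
    be derived by internal induction. *)
Lemma ltN_elt (n : NN) (x : M) : x \eps elv n -> exists m : NN, elv m = x.
Proof.
have : esub (elv n) (omega M); last by move=> H /H xN; exists (MkEl xN).
apply: (@NN_ind (fun n => esub (elv n) (omega M))) => {n x}.
- apply: (@internal_dfn _ _ _ _ (fun x => forall y, y \eps x -> y \eps omega M)) => //.
  by dfn hM hM.
- by move=> x /in_eempty.
- by move=> n IH x /in_esucc[/IH//|->]; exact: elP.
Qed.

Lemma NN_ext (m n : NN) : (forall k, ltN k m <-> ltN k n) -> m = n.
Proof.
move=> H; apply: elv_inj; apply: ext => x; split=> Hx.
  by have [k Ek] := ltN_elt Hx; rewrite -Ek; apply: (H k).1; rewrite /ltN Ek.
by have [k Ek] := ltN_elt Hx; rewrite -Ek; apply: (H k).2; rewrite /ltN Ek.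
Qed.

Lemma int_ltN2 T {iT : IT M T} (f g : T -> NN) :
  iterm f -> iterm g -> internal (fun t => ltN (f t) (g t)).
Proof. exact: int_comp2 int_ltN. Qed.

Lemma iterm_succN : iterm succN.
Proof.
apply: (int_ext (Q := fun p => forall k, ltN k p.2 <-> ltN k p.1 \/ k = p.1)).
  move=> [m n] /=; split=> [-> k|H]; first exact: ltNS.
  by apply: NN_ext => k; rewrite H ltNS.
by int; refine (int_ltN2 _ _); int.
Qed.

End Naturals.
Arguments NN M : clear implicits.

Ltac int_hook ::= first
  [ refine (int_ltN2 _ _)
  | match goal with |- iterm (fun x => succN (@?f x)) =>
      refine (iterm_comp (g := succN) (f := f) _ _); [exact: iterm_succN|] end
  | exact: iterm_succN ].

Section Order.
Context {M : eps_structure} {hM : ZC M}.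

Lemma ltN_trans (m n k : NN M) : ltN k m -> ltN m n -> ltN k n.
Proof.
move: n m k; apply: (NN_ind (P := fun n => forall m k, ltN k m -> ltN m n -> ltN k n)).
- by int.
- by move=> m k _ /ltN0.
- move=> n IH m k km /ltNS[mn|E]; apply/ltNS; left; first exact: IH mn.
  by rewrite -E.
Qed.

(** In the absence of foundation this is an induction: if n+1 belongs to n+1, then n+1 belongs to n
    or equals n, and either way n belongs to n. *)
Lemma ltNn (n : NN M) : ~ ltN n n.
Proof.
move: n; apply: (NN_ind (P := fun n => ~ ltN n n)).
- by int.
- exact: ltN0.
- move=> n IH /ltNS[Sn|E].
    by apply: IH; apply: ltN_trans Sn; apply/ltNS; right.
  by apply: IH; rewrite -{2}E; apply/ltNS; right.
Qed.

Lemma ltNSn (n : NN M) : ltN n (succN n).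
Proof. by apply/ltNS; right. Qed.

End Order.

Section Restriction.
Context {M : eps_structure} {hM : ZC M} {T : Type} {iT : IT M T}.

(** In [is_finite] and [formal_sum] a sequence has a natural number as its domain, whereas internal
    maps are total on [NN]; this passes from the second kind to the first. *)
Definition restr (f : NN M -> T) (n : NN M) : M :=
  esub_of (fun p : NN M * T => ltN p.1 n /\ p.2 = f p.1).

Lemma internal_restr f n : iterm f ->
  internal (fun p : NN M * T => ltN p.1 n /\ p.2 = f p.1).
Proof. by move=> Hf; int. Qed.

Lemma restr_fun f n (S : M) : iterm f -> (forall i, ltN i n -> enc (f i) \eps S) ->
  is_fun (restr f n) (elv n) S.
Proof.
move=> Hf HS; have Hr := internal_restr n Hf; split.
  move=> z /(in_esub_of Hr)[[i t] /= [[lt_in ->] ->]].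
  by apply/in_eprod_pair; split=> //; exact: HS.
move=> x /[dup] xn /ltN_elt[i Ei]; subst x.
exists (enc (f i)); split.
  by apply/(in_esub_of_enc (i, f i) Hr).
by move=> y /(in_esub_of Hr)[[k t] /= [[_ ->] /(opair_inj hM)[/elv_inj -> ->]]].
Qed.

Lemma app_restr f n i : iterm f -> ltN i n -> app (restr f n) (elv i) = enc (f i).
Proof.
move=> Hf lt_in; have Hr := internal_restr n Hf.
apply/(app_eq _ (restr_fun (S := ran T) Hf _) lt_in).
  by move=> k _; exact: enc_ran.
by apply/(in_esub_of_enc (i, f i) Hr).
Qed.

End Restriction.

(** * Hyperfinite sets as Kuratowski-finite internal sets *)

Section Finite.
Context {M : eps_structure} {hM : ZC M} {T : Type} {iT : IT M T}.

Definition isub_of (P : T -> Prop) (HP : internal P) : isub T := exist _ P HP.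

Definition emptyS : isub T := isub_of (int_cst False).

Lemma int_addS (s : isub T) (x : T) : internal (fun t => s t \/ t = x).
Proof. by int. Qed.

Definition addS (s : isub T) (x : T) : isub T := isub_of (int_addS s x).

Lemma addS_id (s : isub T) (x : T) : s x -> addS s x = s.
Proof. by move=> sx; apply: isub_ext => t /=; split=> [[//|->//]|]; left. Qed.

Lemma iterm_addS : iterm (fun p : isub T * T => addS p.1 p.2).
Proof.
apply: (int_ext (Q := fun p : isub T * T * isub T =>
  forall t, p.2 t <-> p.1.1 t \/ t = p.1.2)); last by int.
move=> [[s x] s'] /=; split=> [->//|H].
by apply: isub_ext => t; rewrite H.
Qed.

Lemma iterm_addS2 U {iU : IT M U} (f : U -> isub T) (g : U -> T) :
  iterm f -> iterm g -> iterm (fun u => addS (f u) (g u)).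
Proof. exact: iterm_comp2 iterm_addS. Qed.

(** The families [W] are internal, so [kfin] is itself an internal predicate and its induction
    principle is immediate; no enumeration has to be carried along. *)
Definition kfin (s : isub T) : Prop := forall W : isub (isub T),
  W emptyS -> (forall s x, W s -> W (addS s x)) -> W s.

Lemma int_kfin : internal kfin.
Proof. by rewrite /kfin; int; apply: iterm_addS2; int. Qed.

Lemma kfin_ind (P : isub T -> Prop) : internal P -> P emptyS ->
  (forall s x, P s -> P (addS s x)) -> forall s, kfin s -> P s.
Proof. by move=> HP P0 PS s Hs; exact: (Hs (exist _ P HP) P0 PS). Qed.

Lemma kfin_empty : kfin emptyS.
Proof. by []. Qed.

Lemma kfin_add s x : kfin s -> kfin (addS s x).
Proof. by move=> Hs W W0 WS; apply: (WS); exact: (Hs W W0 WS). Qed.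

Lemma int_unionS (s s' : isub T) : internal (fun t => s t \/ s' t).
Proof. by int. Qed.

Definition unionS (s s' : isub T) : isub T := isub_of (int_unionS s s').

Lemma int_kfin2 U {iU : IT M U} (f : U -> isub T) :
  iterm f -> internal (fun u => kfin (f u)).
Proof. exact: int_comp int_kfin. Qed.

Lemma kfin_union s s' : kfin s -> kfin s' -> kfin (unionS s s').
Proof.
move=> Hs Hs'.
(* Describing the union by its members makes the induction predicate internal without showing first
   that [unionS] is an internal map. *)
suff : forall u : isub T, (forall t, u t <-> s t \/ s' t) -> kfin u by apply.
move: s' Hs'; apply: kfin_ind => [||s' x IH u Hu].
- by int; refine (int_kfin2 _); int.
- move=> u Hu; suff -> : u = s by [].
  by apply: isub_ext => t; rewrite Hu; split=> [[]//|]; left.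
- suff -> : u = addS (unionS s s') x by apply: kfin_add; exact: IH.
  by apply: isub_ext => t; rewrite Hu /=; tauto.
Qed.

Lemma is_finite_kfin (s : isub T) : is_finite (enc s) -> kfin s.
Proof.
move=> [n0 [f [/(in_omega hM) n0P Hf _ fS]]].
pose n : NN M := MkEl n0P.
have HG : internal (fun p : NN M * T => opair (elv p.1) (enc p.2) \eps f) by exists f.
(* Induction along the enumeration [f]: [u] is the image of the first [i] indices. The guard keeps
   [i] within the domain [n0]. *)
pose (Q := fun i : NN M => esub (elv i) n0 -> forall u : isub T,
  (forall t, u t <-> exists k, ltN k i /\ opair (elv k) (enc t) \eps f) -> kfin u).
have HQ : internal Q.
  apply: int_imp.
    apply: (@internal_dfn _ _ _ _ (fun x => forall y, y \eps x -> y \eps n0)) => //.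
    by dfn hM hM.
  int; last by refine (int_kfin2 _); int.
  by apply: (int_comp (f := fun p : NN M * isub T * T * NN M => (p.2, p.1.2)) HG); int.
have : Q n.
  apply: NN_ind => //.
    move=> _ u Hu; suff -> : u = emptyS by [].
    by apply: isub_ext => t; rewrite Hu; split=> // -[k [/ltN0]].
  move=> i IH Si u Hu.
  have i_n0 : elv i \eps n0 by apply: Si; exact: ltNSn.
  have /(ranP (IT:=iT)) : app f (elv i) \eps ran T.
    have := app_in Hf i_n0; rewrite (in_esub_of (isubP s)) => -[t [_ ->]].
    exact: enc_ran.
  move=> [x Ex].
  have Hi : internal (fun t : T =>
      exists k : NN M, ltN k i /\ opair (elv k) (enc t) \eps f).
    int; by apply: (int_comp (f := fun p : T * NN M => (p.2, p.1)) HG); int.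
  have -> : u = addS (isub_of Hi) x.
    apply: isub_ext => t; rewrite Hu /=; split.
      move=> [k [/ltNS[ki|->] kt]]; first by left; exists k.
      by right; apply: enc_inj; rewrite Ex; apply/esym/(app_eq _ Hf).
    move=> [[k [ki kt]]|->]; first by exists k; split=> //; apply/ltNS; left.
    exists i; split; first exact: ltNSn.
    by apply/(app_eq _ Hf).
  apply: kfin_add; apply: IH => //.
  by move=> y yi; apply: Si; apply/in_esucc; left.
apply=> // t; rewrite -(in_esub_of_enc t (isubP s)); split=> [ts|[k [kn kt]]].
  have [x [xn Ex]] := fS _ ts; have [k Ek] := @ltN_elt _ _ n _ xn.
  by exists k; rewrite /ltN Ek; split=> //; apply/(app_eq _ Hf).
by have /in_eprod_pair[] := Hf.1 _ kt.
Qed.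

(** The empty set is a case apart because internal maps are total: [ifun (NN M) T] has no element
    when [T] has none. *)
Definition bij_finite (s : isub T) : Prop :=
  s = emptyS \/ exists (n : NN M) (f : ifun (NN M) T),
  (forall i k, ltN i n -> ltN k n -> f i = f k -> i = k) /\
  (forall t, s t <-> exists i, ltN i n /\ f i = t).

Lemma kfin_bij s : kfin s -> bij_finite s.
Proof.
move: s; apply: kfin_ind; [by rewrite /bij_finite; int|by left|].
move=> s x; have [sx|nsx] := EM (s x).
  by rewrite (addS_id sx).
move=> [->|[n [f [f_inj fs]]]]; right.
  have Hc : iterm (fun _ : NN M => x) by int.
  exists (succN zeroN), (exist _ _ Hc); split.
    by move=> i k /ltNS[/ltN0//|->] /ltNS[/ltN0//|->].
  move=> t /=; split=> [[//|->]|[i [_ <-]]]; last by right.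
  by exists zeroN; split=> //; exact: ltNSn.
have Hg : iterm (fun i : NN M => if `[< i = n >] then x else f i) by int.
have [g gE] : exists g : ifun (NN M) T, forall i, g i =
    if `[< i = n >] then x else f i by exists (exist _ _ Hg).
have gn : g n = x by rewrite gE; case: asboolP.
have gi i : ltN i n -> g i = f i.
  by move=> lt_in; rewrite gE; case: asboolP => // E;
    case: (@ltNn _ _ n); rewrite -{1}E.
exists (succN n), g; split.
  move=> i k /ltNS[lt_in|->] /ltNS[lt_kn|->] //; rewrite ?gn ?gi //.
  - exact: f_inj.
  - by move=> E; case: nsx; apply/fs; exists i.
  - by move=> E; case: nsx; apply/fs; exists k.
move=> t /=; split=> [[/fs[i [lt_in <-]]|->]|[i [/ltNS[lt_in|->]]]].
- by exists i; split; [apply/ltNS; left|rewrite gi].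
- by exists n; split; [exact: ltNSn|rewrite gn].
- by rewrite gi // => <-; left; apply/fs; exists i.
- by rewrite gn => <-; right.
Qed.

Lemma kfin_is_finite (s : isub T) : kfin s -> is_finite (enc s).
Proof.
move=> /kfin_bij[->|[n [f [f_inj fs]]]].
  have E0 z : ~ z \eps enc emptyS by move=> /(in_esub_of (isubP emptyS))[t []].
  exists eempty, eempty; split.
  - by apply/in_omega; exact: (elP zeroN).
  - by split=> x /in_eempty.
  - by move=> i k /in_eempty.
  - by move=> y /E0.
exists (elv n), (restr f n); split.
- by apply/in_omega; exact: elP.
- apply: restr_fun; first exact: ifunP.
  by move=> i lt_in; apply/(in_esub_of_enc _ (isubP s))/fs; exists i.
- move=> x y /[dup] xn /ltN_elt[i Ei] /[dup] yn /ltN_elt[k Ek]; subst x y.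
  rewrite !app_restr //; try exact: ifunP.
  by move=> /enc_inj/f_inj ->.
- move=> y /(in_esub_of (isubP s))[t [/fs[i [lt_in <-]] ->]].
  by exists (elv i); split=> //; rewrite app_restr //; exact: ifunP.
Qed.

End Finite.

Import GRing.Theory.
Local Open Scope ring_scope.

(** * Chains with values in an internal abelian group *)

Record izmod (M : eps_structure) (hM : ZC M) := IZmod {
  izsort :> zmodType;
  izIT : IT M izsort;
  izadd : iterm (fun p : izsort * izsort => p.1 + p.2) }.
Existing Instance izIT.

Section InternalGroups.
Context {M : eps_structure} {hM : ZC M} (V : izmod hM) {T : Type} {iT : IT M T}.
Implicit Types f g : T -> V.

Lemma iterm_add f g : iterm f -> iterm g -> iterm (fun t => f t + g t).
Proof. exact: iterm_comp2 (izadd V). Qed.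

(** The opposite is definable from addition, as the solution of y + f t = 0; so [izmod] asks for
    internality of addition only. *)
Lemma iterm_opp f : iterm f -> iterm (fun t => - f t).
Proof.
move=> Hf; apply: (int_ext (Q := fun p : T * V => p.2 + f p.1 = 0)).
  move=> [t v] /=; split=> [->|/eqP]; first by rewrite addNr.
  by rewrite addr_eq0 => /eqP.
have H : iterm (fun p : T * V => p.2 + f p.1) by apply: iterm_comp2 (izadd V) _ _; int.
by int.
Qed.

End InternalGroups.

Lemma iterm_sub (M : eps_structure) (hM : ZC M) (V : izmod hM) T {iT : IT M T}
  (f g : T -> V) : iterm f -> iterm g -> iterm (fun t => f t - g t).
Proof. by move=> Hf Hg; apply: iterm_add => //; exact: iterm_opp. Qed.

Ltac int_group := lazymatch goal with
  | |- iterm (fun x => @?f x + @?g x) => refine (iterm_add (f := f) (g := g) _ _)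
  | |- iterm (fun x => - @?f x) => refine (iterm_opp (f := f) _)
  end.

Ltac int_hook ::= first
  [ int_group
  | match goal with |- iterm (fun x => succN (@?f x)) =>
      refine (iterm_comp (g := succN) (f := f) _ _); [exact: iterm_succN|] end
  | match goal with |- internal (fun x => ltN (@?f x) (@?g x)) =>
      refine (int_ltN2 (f := f) (g := g) _ _) end
  | match goal with |- internal (fun x => kfin (@?f x)) =>
      refine (int_kfin2 (f := f) _) end ].

Section Chains.
Context {M : eps_structure} {hM : ZC M} (S : Type) {iS : IT M S} (V : izmod hM).

Definition fin_supported (f : S -> V) : Prop :=
  exists s : isub S, kfin s /\ forall x, ~ s x -> f x = 0.

Record chain := Chain {
  ev :> S -> V;
  ev_iterm : iterm ev;
  ev_fin : fin_supported ev }.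

Lemma chain_ext (c d : chain) : (forall x, c x = d x) -> c = d.
Proof.
case: c d => [f Hf f0] [g Hg g0] /= /funext E; subst g.
by congr Chain; exact: Prop_irrelevance.
Qed.

HB.instance Definition _ := gen_eqMixin chain.
HB.instance Definition _ := gen_choiceMixin chain.

Lemma zero_fin : fin_supported (fun _ => 0).
Proof. by exists emptyS; split=> //; exact: kfin_empty. Qed.
Definition zero_chain : chain := Chain (iterm_cst 0) zero_fin.

Lemma add_fin (c d : chain) : fin_supported (fun x => c x + d x).
Proof.
have [s [Hs cs]] := ev_fin c; have [s' [Hs' ds]] := ev_fin d.
exists (unionS s s'); split; first exact: kfin_union.
by move=> x /= /not_orP[/cs -> /ds ->]; rewrite addr0.
Qed.
Definition add_chain (c d : chain) : chain :=
  Chain (iterm_add (ev_iterm c) (ev_iterm d)) (add_fin c d).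

Lemma opp_fin (c : chain) : fin_supported (fun x => - c x).
Proof.
have [s [Hs cs]] := ev_fin c; exists s; split=> // x /cs ->.
by rewrite oppr0.
Qed.
Definition opp_chain (c : chain) : chain :=
  Chain (iterm_opp (ev_iterm c)) (opp_fin c).

Lemma chain_addA : associative add_chain.
Proof. by move=> a b c; apply: chain_ext => x /=; rewrite addrA. Qed.
Lemma chain_addC : commutative add_chain.
Proof. by move=> a b; apply: chain_ext => x /=; rewrite addrC. Qed.
Lemma chain_add0 : left_id zero_chain add_chain.
Proof. by move=> a; apply: chain_ext => x /=; rewrite add0r. Qed.
Lemma chain_addN : left_inverse zero_chain opp_chain add_chain.
Proof. by move=> a; apply: chain_ext => x /=; rewrite addNr. Qed.

HB.instance Definition _ :=
  GRing.isZmodule.Build chain chain_addA chain_addC chain_add0 chain_addN.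

Definition ifun_of_chain (c : chain) : ifun S V := exist _ (ev c) (ev_iterm c).

Lemma int_fin_supported :
  internal (fun f : ifun S V =>
    exists s : isub S, kfin s /\ forall x, ~ s x -> f x = 0).
Proof. by int. Qed.

#[local] Obligation Tactic := idtac.
Program Instance IT_chain : IT M chain := {|
  enc := fun c => graph (ev c);
  ran := esub_of
    (fun f : ifun S V => exists s : isub S, kfin s /\ forall x, ~ s x -> f x = 0) |}.
Next Obligation.
move=> c d E; apply: chain_ext => x; apply: enc_inj.
by rewrite -(app_graph x (ev_iterm c)) E app_graph //; exact: ev_iterm.
Qed.
Next Obligation.
move=> x; rewrite (in_esub_of int_fin_supported); split.
  by move=> [f [Hf ->]]; exists (Chain (ifunP f) Hf).
by move=> [c <-]; exists (ifun_of_chain c); split=> //; exact: ev_fin.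
Qed.

Lemma iterm_ifun_of_chain : iterm ifun_of_chain.
Proof.
apply: (@internal_dfn _ _ _ _ (fun x => exists y, x = opair y y)); first by dfn hM hM.
move=> [c f] /=; split=> [->|[y /(opair_inj hM)[<- E]]]; first by exists (graph c).
exact: (enc_inj (x1 := f) (x2 := ifun_of_chain c) E).
Qed.

Lemma iterm_ev U {iU : IT M U} (f : U -> chain) (g : U -> S) :
  iterm f -> iterm g -> iterm (fun u => f u (g u)).
Proof.
move=> Hf Hg; apply: (iterm_app (F := fun u => ifun_of_chain (f u))) => //.
by apply: iterm_comp Hf; exact: iterm_ifun_of_chain.
Qed.

Lemma iterm_add_chain : iterm (fun p : chain * chain => p.1 + p.2).
Proof.
apply: (int_ext (Q := fun p : chain * chain * chain =>
  forall x, p.2 x = p.1.1 x + p.1.2 x)).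
  by move=> [[c d] b] /=; split=> [->//|H]; exact: chain_ext.
by int; try int_group; apply: iterm_ev; int.
Qed.

(** Chains form an internal group in their turn, so maps into chain groups fall under the extension
    result [hom_extension]. *)
Definition chainZ : izmod hM := IZmod iterm_add_chain.

Lemma iterm_term_fun (g : V) (x : S) : iterm (fun y => if `[< y = x >] then g else 0).
Proof. by int. Qed.
Lemma term_fin (g : V) (x : S) : fin_supported (fun y => if `[< y = x >] then g else 0).
Proof.
exists (addS emptyS x); split; first exact: kfin_add kfin_empty.
by move=> y /= H; case: asboolP => // E; case: H; right.
Qed.
Definition term (g : V) (x : S) : chainZ := Chain (iterm_term_fun g x) (term_fin g x).

Lemma termE g x y : term g x y = if `[< y = x >] then g else 0.
Proof. by []. Qed.

Lemma term_eq g x : term g x x = g.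
Proof. by rewrite termE; case: asboolP. Qed.

Lemma term_neq g x y : y <> x -> term g x y = 0.
Proof. by rewrite termE; case: asboolP. Qed.

Lemma termD g h x : term (g + h) x = term g x + term h x.
Proof.
by apply: chain_ext => y /=; case: asboolP; rewrite ?addr0.
Qed.

Lemma iterm_term0 : iterm (fun p : V * S => term p.1 p.2).
Proof.
apply: (int_ext (Q := fun p : (V * S) * chainZ =>
  forall y, (y = p.1.2 -> p.2 y = p.1.1) /\ (y <> p.1.2 -> p.2 y = 0))).
  move=> [[g x] c] /=; split=> [-> y|H].
    by split=> [->|]; [exact: term_eq|exact: term_neq].
  apply: chain_ext => y; have [Hx Hy] := H y; rewrite termE.
  by case: asboolP => [/Hx|/Hy].
by int; try int_group; apply: iterm_ev; int.
Qed.

Lemma iterm_term U {iU : IT M U} (f : U -> V) (g : U -> S) :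
  iterm f -> iterm g -> iterm (fun u => term (f u) (g u)).
Proof. exact: iterm_comp2 iterm_term0. Qed.

End Chains.
Existing Instance IT_chain.
Arguments chain {M hM} S {iS} V.
Arguments chainZ {M hM} S {iS} V.

Ltac int_group ::= lazymatch goal with
  | |- iterm (fun x => @?f x + @?g x) => refine (iterm_add (f := f) (g := g) _ _)
  | |- iterm (fun x => - @?f x) => refine (iterm_opp (f := f) _)
  | |- iterm (fun x => ev (@?f x) (@?g x)) => refine (iterm_ev (f := f) (g := g) _ _)
  | |- iterm (fun x => term (@?f x) (@?g x)) =>
      refine (iterm_term (f := f) (g := g) _ _)
  end.

(** * The universal property of the internal chain group *)

Section Generation.
Context {M : eps_structure} {hM : ZC M} {S : Type} {iS : IT M S} {V : izmod hM}.
Implicit Types (c d : chainZ S V).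

Definition supported (s : S -> Prop) c : Prop := forall x, ~ s x -> c x = 0.

Lemma addE c d x : (c + d) x = c x + d x. Proof. by []. Qed.
Lemma oppE c x : (- c) x = - c x. Proof. by []. Qed.

Lemma supported_fin c : exists s, kfin s /\ supported s c.
Proof. exact: ev_fin. Qed.

Lemma supported_add s c d : supported s c -> supported s d -> supported s (c + d).
Proof. by move=> Hc Hd x nsx; rewrite addE Hc // Hd // addr0. Qed.

Lemma supported_term (s : S -> Prop) g x : s x -> supported s (term g x).
Proof. by move=> sx y nsy; apply: term_neq => E; apply: nsy; rewrite E. Qed.

(** Kuratowski induction on a finite support, splitting off one term at a time. The set [s0]
    controls which simplices may occur in these terms, so that a bound on the support of [c]
    survives the induction. *)
Lemma chain_ind (P : chainZ S V -> Prop) (s0 : isub S) : internal P -> P 0 ->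
  (forall c g x, s0 x -> P c -> P (c + term g x)) ->
  forall c, supported s0 c -> P c.
Proof.
move=> HP P0 PS c Hc; have [s [Hs cs]] := supported_fin c.
move: s Hs c Hc cs; apply: kfin_ind.
- by rewrite /supported; int.
- move=> c _ H; suff -> : c = 0 by [].
  by apply: chain_ext => x; rewrite H.
(* If [c] vanishes at [x], it is already supported on [s]; otherwise [x] lies in [s0] and
   subtracting the term at [x] brings the support into [s]. *)
move=> s x IH c Hc cs; have [cx|cx] := EM (c x = 0).
  apply: IH => // y nsy; have [->//|yx] := EM (y = x).
  by apply: cs => -[].
have s0x : s0 x by apply: contrapT => /Hc.
have -> : c = c - term (c x) x + term (c x) x by rewrite subrK.
apply: PS => //; apply: IH => y Hy; rewrite addE oppE.
  rewrite Hc // term_neq ?subrr // => E.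
  by rewrite E in Hy.
have [->|yx] := EM (y = x); first by rewrite term_eq subrr.
by rewrite term_neq // subr0; apply: cs => -[].
Qed.

Lemma int_true : internal (fun _ : S => True). Proof. exact: int_cst. Qed.
Definition fullS : isub S := isub_of int_true.

Context {W : izmod hM}.

Definition addmap (A B : zmodType) (f : A -> B) : Prop :=
  forall a b, f (a + b) = f a + f b.

Lemma addmap0 (A B : zmodType) (f : A -> B) : addmap f -> f 0 = 0.
Proof. by move=> H; apply: (addrI (f 0)); rewrite -H !addr0. Qed.

Lemma addmapN (A B : zmodType) (f : A -> B) a : addmap f -> f (- a) = - f a.
Proof.
move=> H; apply: (addrI (f a)).
by rewrite -H !subrr addmap0.
Qed.

Lemma addmap_eq_on (s : isub S) (D E : chainZ S V -> W) :
  iterm D -> iterm E -> addmap D -> addmap E ->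
  (forall g x, s x -> D (term g x) = E (term g x)) ->
  forall c, supported s c -> D c = E c.
Proof.
move=> iD iE aD aE H; apply: chain_ind.
- by int.
- by rewrite !addmap0.
- by move=> c g x sx IH; rewrite aD aE IH H.
Qed.

Lemma addmap_eq (D E : chainZ S V -> W) : iterm D -> iterm E -> addmap D -> addmap E ->
  (forall g x, D (term g x) = E (term g x)) -> D =1 E.
Proof.
by move=> iD iE aD aE H c; apply: (@addmap_eq_on fullS) => // x [].
Qed.

Section Extension.
Variable F : V -> S -> W.
Hypothesis iF : iterm (fun p : V * S => F p.1 p.2).
Hypothesis aF : forall x, addmap (F^~ x).

Implicit Types D : ifun (chainZ S V) W.

(** Killing the terms off [s] makes [D] a total map on chains, hence an element of the coded type
    [ifun]; its values are the intended ones on the chains supported on [s]. *)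
Definition hom_on (s : isub S) D : Prop :=
  (forall c d, D (c + d) = D c + D d) /\
  (forall g x, (s x -> D (term g x) = F g x) /\ (~ s x -> D (term g x) = 0)).

Lemma iterm_F U {iU : IT M U} (f : U -> V) (g : U -> S) :
  iterm f -> iterm g -> iterm (fun u => F (f u) (g u)).
Proof. exact: iterm_comp2 iF. Qed.

Lemma int_hom_on : internal (fun p : isub S * ifun (chainZ S V) W => hom_on p.1 p.2).
Proof. by rewrite /hom_on; int; apply: iterm_F; int. Qed.

(* Kuratowski induction: add F (c x) x to the map already built on s. *)
Lemma hom_on_ex s : kfin s -> exists D, hom_on s D.
Proof.
move: s; apply: kfin_ind.
- by int; apply: (int_comp2 int_hom_on); int.
- have i0 : iterm (fun _ : chainZ S V => 0 : W) by int.
  by exists (exist _ _ i0); split=> [c d|g x]; rewrite /ifun_fun /= ?addr0 //.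
move=> s x [D [aD HD]]; have [sx|nsx] := EM (s x).
  by rewrite (addS_id sx); exists D.
have iD : iterm (fun c : chainZ S V => D c + F (c x) x) by int; apply: iterm_F; int.
have [D' D'E] : exists D' : ifun (chainZ S V) W, forall c, D' c = D c + F (c x) x.
  by exists (exist _ _ iD).
exists D'; split=> [c d|g y]; first by rewrite !D'E aD addE aF addrACA.
rewrite D'E.
have [->|yx] := EM (y = x).
  split=> [_|H]; last by case: H; right.
  by rewrite (HD g x).2 // term_eq add0r.
rewrite term_neq; last by move=> E; apply: yx.
rewrite (addmap0 (@aF x)) addr0; split=> [[sy|//]|H]; first exact: (HD g y).1 sy.
by apply: (HD g y).2 => sy; apply: H; left.
Qed.

Lemma hom_on_eq s s' D D' c : hom_on s D -> hom_on s' D' ->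
  supported s c -> supported s' c -> D c = D' c.
Proof.
move=> [aD HD] [aD' HD'] cs cs'.
have Hi : internal (fun x => s x /\ s' x) by int.
apply: (@addmap_eq_on (isub_of Hi)) => //; try exact: ifunP.
  by move=> g x [sx s'x]; rewrite (HD g x).1 // (HD' g x).1.
by move=> x /not_andP[/cs|/cs'].
Qed.

(** The maps built on the finite sets [s] agree on common supports and glue to one homomorphism. The
    boundary, the induced chain maps and the prism operator are all obtained from this. *)
Lemma hom_extension : exists E : chainZ S V -> W, [/\ iterm E, addmap E &
  forall g x, E (term g x) = F g x].
Proof.
(* [E] is picked pointwise by external choice, but its graph is this relation, which quantifies over
   coded types and is therefore internal. *)
pose (Q := fun (c : chainZ S V) (w : W) => exists (s : isub S)
  (D : ifun (chainZ S V) W), kfin s /\ hom_on s D /\ supported s c /\ D c = w).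
have Qex c : exists w, Q c w.
  have [s [Hs cs]] := supported_fin c; have [D HD] := hom_on_ex Hs.
  by exists (D c), s, D.
have Qu c w w' : Q c w -> Q c w' -> w = w'.
  move=> [s [D [Hs [HD [cs <-]]]]] [s' [D' [Hs' [HD' [cs' <-]]]]].
  exact: hom_on_eq HD HD' cs cs'.
pose (E := fun c => projT1 (cid (Qex c))).
have QE c : Q c (E c) by rewrite /E; case: cid.
have EQ s D c : kfin s -> hom_on s D -> supported s c -> E c = D c.
  by move=> Hs HD cs; apply: (Qu c) => //; exists s, D.
exists E; split.
- apply: (int_ext (Q := fun p => Q p.1 p.2)).
    by move=> [c w] /=; split=> [->//|/Qu]; apply.
  by rewrite /Q /supported; int; apply: (int_comp2 int_hom_on); int.
- move=> c d; have [s [Hs cs]] := supported_fin c.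
  have [s' [Hs' ds']] := supported_fin d.
  have Hu := kfin_union Hs Hs'; have [D HD] := hom_on_ex Hu.
  have cu : supported (unionS s s') c by move=> x /not_orP[/cs].
  have du : supported (unionS s s') d by move=> x /not_orP[_ /ds'].
  by rewrite !(EQ _ _ _ Hu HD) //; [exact: HD.1|exact: supported_add].
- move=> g x; have Hx : kfin (addS emptyS x) by apply: kfin_add; exact: kfin_empty.
  have [D HD] := hom_on_ex Hx; rewrite (EQ _ _ _ Hx HD).
    by apply: (HD.2 g x).1; right.
  by apply: supported_term; right.
Qed.

End Extension.
End Generation.

(** * Simplices, alternating sums of faces and the prism operator *)

(** Nested pairs ending in [tt] mirror the codes of simplices, so that the range of [tup (El X) n]
    is literally [epow X n]. *)
Fixpoint tup (T : Type) (n : nat) : Type :=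
  if n is m.+1 then (T * tup T m)%type else unit.

Fixpoint tmap (T T' : Type) (h : T -> T') (n : nat) : tup T n -> tup T' n :=
  if n is m.+1 then fun l => (h l.1, tmap h l.2) else fun=> tt.

Fixpoint tupof (T : Type) (n : nat) : ('I_n -> T) -> tup T n :=
  if n is m.+1 then fun b => (b ord0, tupof (fun i => b (lift ord0 i)))
  else fun=> tt.

Section FaceSums.
Variables (T : Type) (V : zmodType).

(** The alternating sum of f over the faces: either the first vertex is dropped, or it is kept and a
    face of the tail is taken, with its sign reversed by the shift of indices. *)
Fixpoint delta (n : nat) : (tup T n -> V) -> tup T n.+1 -> V :=
  if n is m.+1 return (tup T n -> V) -> tup T n.+1 -> V
  then fun f l => f l.2 - delta (fun l' => f (l.1, l')) l.2
  else fun f l => f l.2.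

(* The sum of the (-1)^i f (x_0, ..., x_i, r x_i, ..., r x_(n-1)). *)
Fixpoint prism (r : T -> T) (n : nat) : (tup T n.+1 -> V) -> tup T n -> V :=
  if n is m.+1 return (tup T n.+1 -> V) -> tup T n -> V
  then fun f l => f (l.1, (r l.1, tmap r l.2)) - prism r (fun l' => f (l.1, l')) l.2
  else fun f l => 0.

Lemma deltaS n (f : tup T n.+1 -> V) x l :
  delta f (x, l) = f l - delta (fun l' => f (x, l')) l.
Proof. by []. Qed.

Lemma prismS r n (f : tup T n.+2 -> V) x l :
  prism r f (x, l) = f (x, (r x, tmap r l)) - prism r (fun l' => f (x, l')) l.
Proof. by []. Qed.

Lemma eq_delta n (f g : tup T n -> V) : f =1 g -> delta f =1 delta g.
Proof. by move=> /funext ->. Qed.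

Lemma eq_prism r n (f g : tup T n.+1 -> V) : f =1 g -> prism r f =1 prism r g.
Proof. by move=> /funext ->. Qed.

Lemma deltaD n (f g : tup T n -> V) l :
  delta (fun l => f l + g l) l = delta f l + delta g l.
Proof.
by elim: n f g l => [//|n IH] f g [x l]; rewrite !deltaS IH opprD addrACA.
Qed.

Lemma prismD r n (f g : tup T n.+1 -> V) l :
  prism r (fun l => f l + g l) l = prism r f l + prism r g l.
Proof.
elim: n f g l => [|n IH] f g l; first by rewrite /= addr0.
by case: l => x l; rewrite !prismS IH opprD addrACA.
Qed.

Lemma deltaB n (f g : tup T n -> V) l :
  delta (fun l => f l - g l) l = delta f l - delta g l.
Proof.
apply/eqP; rewrite eq_sym subr_eq -deltaD; apply/eqP/eq_delta => l'.
by rewrite subrK.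
Qed.

Lemma prismB r n (f g : tup T n.+1 -> V) l :
  prism r (fun l => f l - g l) l = prism r f l - prism r g l.
Proof.
apply/eqP; rewrite eq_sym subr_eq -prismD; apply/eqP/eq_prism => l'.
by rewrite subrK.
Qed.

Lemma delta_tupof n (f : tup T n -> V) (b : 'I_n.+1 -> T) :
  delta f (tupof b) = \sum_(i < n.+1)
    (if odd i then - f (tupof (fun k => b (lift i k)))
     else f (tupof (fun k => b (lift i k)))).
Proof.
elim: n f b => [|n IH] f b; first by rewrite big_ord1.
rewrite big_ord_recl /=; congr (_ + _).
rewrite (IH (fun l' => f (b ord0, l')) (fun i => b (lift ord0 i))) -sumrN.
apply: eq_bigr => i _; rewrite /bump /=.
have E : (b ord0, tupof (fun k => b (lift ord0 (lift i k)))) =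
    tupof (fun k => b (lift (lift ord0 i) k)).
  rewrite /=; congr (b _, tupof _); first exact: val_inj.
  apply/funext => k; congr b; apply: val_inj => /=.
  by rewrite /bump /= add1n ltnS; case: (leqP i k).
by rewrite E add0n; case: (odd i); rewrite /= ?opprK.
Qed.

End FaceSums.

Lemma delta_tmap (T T' : Type) (V : zmodType) (h : T -> T') n
    (f : tup T' n -> V) l :
  delta f (tmap h l) = delta (fun l => f (tmap h l)) l.
Proof.
elim: n f l => [//|n IH] f [x l].
by rewrite deltaS -[in RHS](IH (fun l => f (h x, l))).
Qed.

(** The homotopy identity for an arbitrary function of tuples, by induction on the number of
    vertices. Splitting off the first vertex [x] and writing [fx] for f with [x] in front, the mixed
    terms cancel and the induction hypothesis for [fx] leaves f (r x, r l) - fx (r l) + fx (r l) -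
    fx l. *)
Lemma prism_delta (T : Type) (V : zmodType) (r : T -> T) n (f : tup T n.+1 -> V) l :
  prism r (delta f) l + delta (prism r f) l = f (tmap r l) - f l.
Proof.
elim: n f l => [|n IH] f.
  by move=> [x []]; rewrite /= subr0 addr0.
suff : forall x (l : tup T n.+1), prism r (delta f) (x, l) + delta (prism r f) (x, l) =
    f (tmap r ((x, l) : tup T n.+2)) - f (x, l) by move=> H [x l]; exact: H.
move=> x l; pose (fx := fun l' : tup T n.+1 => f (x, l')).
have E1 : prism r (fun l' : tup T n.+2 => delta f (x, l')) l =
    prism r f l - prism r (delta fx) l.
  by rewrite -prismB.
have E2 : delta (fun l' : tup T n => prism r f (x, l')) l =
    delta (fun l' : tup T n => fx (r x, tmap r l')) l - delta (prism r fx) l.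
  by rewrite -deltaB.
have E3 : delta f (x, (r x, tmap r l)) = f (r x, tmap r l) -
    (fx (tmap r l) - delta (fun l' : tup T n => fx (r x, l')) (tmap r l)) by [].
(* Here a and b are the values of f at (r x, r l) and (x, r l), and c sums f (x, r x, -) over the
   faces of r l. P is the prism of f on l, while Q + R is the left side of the induction hypothesis
   for [fx]. *)
have zmodE (a b c P Q R : V) :
    (a - (b - c)) - (P - Q) + (P - (c - R)) = a - b + (Q + R).
  rewrite !opprB -!addrA; congr (a + _).
  rewrite addKr addrCA; congr (- b + _).
  by rewrite addrC -!addrA addNr addr0.
have -> : prism r (delta f) (x, l) + delta (prism r f) (x, l) =
    (delta f (x, (r x, tmap r l)) - prism r (fun l' : tup T n.+2 => delta f (x, l')) l)
    + (prism r f l - delta (fun l' : tup T n => prism r f (x, l')) l) by [].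
by rewrite E1 E2 E3 delta_tmap zmodE IH subrKA.
Qed.

Lemma addmap_delta (T : Type) (V W : zmodType) (D : V -> W) n (f : tup T n -> V) l :
  addmap D -> D (delta f l) = delta (fun l => D (f l)) l.
Proof.
move=> aD; elim: n f l => [//|n IH] f [x l].
by rewrite !deltaS aD addmapN // IH.
Qed.

Lemma addmap_prism (T : Type) (V W : zmodType) (D : V -> W) r n
    (f : tup T n.+1 -> V) l :
  addmap D -> D (prism r f l) = prism r (fun l => D (f l)) l.
Proof.
move=> aD; elim: n f l => [|n IH] f l; first by rewrite /= addmap0.
by case: l => x l; rewrite !prismS aD addmapN // IH.
Qed.

Section InternalTuples.
Context {M : eps_structure} {hM : ZC M} {T : Type} {iT : IT M T}.

Fixpoint IT_tup (n : nat) : IT M (tup T n) :=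
  if n is m.+1 return IT M (tup T n) then IT_prod (iT' := IT_tup m) else IT_unit.
Existing Instance IT_tup.

(** The parameter type [U] is arbitrary because each step of the recursion moves the first vertex
    from the tuple to the parameters. *)
Lemma iterm_delta (V : izmod hM) n U {iU : IT M U} (F : U -> tup T n -> V) :
  iterm (fun q : U * tup T n => F q.1 q.2) ->
  iterm (fun q : U * tup T n.+1 => delta (F q.1) q.2).
Proof.
elim: n U iU F => [|n IH] U iU F HF.
  by apply: (iterm_comp2 HF); int.
apply: iterm_sub.
  by apply: (iterm_comp2 HF); int.
have HG : iterm (fun q : (U * T) * tup T n => F q.1.1 (q.1.2, q.2)).
  by apply: (iterm_comp2 HF); int.
have := IH (U * T)%type _ (fun q (l : tup T n) => F q.1 (q.2, l)) HG => HD.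
apply: (iterm_comp2 (F := fun (q : U * T) (l : tup T n.+1) =>
  delta (fun l' : tup T n => F q.1 (q.2, l')) l)
  (f := fun p : U * tup T n.+2 => (p.1, p.2.1)) (g := fun p => p.2.2) HD); int.
Qed.

Lemma iterm_prism (r : T -> T) (V : izmod hM) n U {iU : IT M U}
    (F : U -> tup T n.+1 -> V) : iterm r -> (forall m, iterm (@tmap T T r m)) ->
  iterm (fun q : U * tup T n.+1 => F q.1 q.2) ->
  iterm (fun q : U * tup T n => prism r (F q.1) q.2).
Proof.
move=> Hr Ht; elim: n U iU F => [|n IH] U iU F HF; first exact: iterm_cst.
apply: iterm_sub.
  apply: (iterm_comp2 HF); int.
  by apply: (iterm_comp (f := fun q : U * tup T n.+1 => q.2.2) (Ht n)); int.
have HG : iterm (fun q : (U * T) * tup T n.+1 => F q.1.1 (q.1.2, q.2)).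
  by apply: (iterm_comp2 HF); int.
have := IH (U * T)%type _ (fun q (l : tup T n.+1) => F q.1 (q.2, l)) HG => HD.
apply: (iterm_comp2 (F := fun (q : U * T) (l : tup T n) =>
  prism r (fun l' : tup T n.+1 => F q.1 (q.2, l')) l)
  (f := fun p : U * tup T n.+1 => (p.1, p.2.1)) (g := fun p => p.2.2) HD); int.
Qed.

End InternalTuples.
Existing Instance IT_tup.

Lemma iterm_tmap (M : eps_structure) (hM : ZC M) T T' {iT : IT M T} {iT' : IT M T'}
  (h : T -> T') n : iterm h -> iterm (@tmap T T' h n).
Proof.
move=> Hh; elim: n => [|n IH]; first exact: iterm_cst.
apply: iterm_pair; first by int.
by apply: (iterm_comp (f := fun q : tup T n.+1 => q.2) IH); int.
Qed.

(** * The internal chain groups and their boundary map *)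

Section CoefficientGroup.
Context {M : eps_structure} {hM : ZC M} {G plus : M}.
Hypothesis hG : abelian_group G plus.

(** The proof is an index of the type because the group structure attached to it depends on [plus]
    and [hG], which [El G] does not mention. *)
Definition Gt of abelian_group G plus := El G.
Local Notation GT := (Gt hG).

Lemma gadd_in (x y : M) : x \eps G -> y \eps G -> gadd plus x y \eps G.
Proof. by move=> xG yG; apply: (app_in (gadd_fun hG)); apply/in_eprod_pair. Qed.

Definition addG (x y : GT) : GT := MkEl (gadd_in (elP x) (elP y)).

Lemma gzeroP : gzero G plus \eps G /\
  forall x, x \eps G -> gadd plus (gzero G plus) x = x.
Proof.
have [e [eG e0 _]] := gadd_zero_opp hG.
apply: (getPex (P := [set e | e \eps G /\ forall x, x \eps G -> gadd plus e x = x])).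
by exists e.
Qed.

Definition zeroG : GT := MkEl gzeroP.1.

Lemma goppP (x : M) : x \eps G ->
  gopp G plus x \eps G /\ gadd plus x (gopp G plus x) = gzero G plus.
Proof.
move=> xG; have [z0G z0] := gzeroP.
apply: (getPex (P := [set y | y \eps G /\ gadd plus x y = gzero G plus])).
have [e [eG e0 /(_ _ xG)[y [yG xy]]]] := gadd_zero_opp hG.
by exists y; split=> //; rewrite xy -[LHS]z0 // (gaddC hG) // e0.
Qed.

Definition oppG (x : GT) : GT := MkEl (goppP (elP x)).1.

HB.instance Definition _ := gen_eqMixin GT.
HB.instance Definition _ := gen_choiceMixin GT.

Lemma addGA : associative addG.
Proof. by move=> x y z; apply: elv_inj; exact: (gaddA hG (elP x) (elP y) (elP z)). Qed.
Lemma addGC : commutative addG.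
Proof. by move=> x y; apply: elv_inj; exact: (gaddC hG (elP x) (elP y)). Qed.
Lemma addG0 : left_id zeroG addG.
Proof. by move=> x; apply: elv_inj; exact: (gzeroP.2 _ (elP x)). Qed.
Lemma addGN : left_inverse zeroG oppG addG.
Proof.
move=> x; rewrite addGC; apply: elv_inj; exact: (goppP (elP x)).2.
Qed.

HB.instance Definition _ := GRing.isZmodule.Build GT addGA addGC addG0 addGN.

Definition IT_Gt : IT M GT := IT_El G.

Lemma iterm_addG : iterm (iT := IT_prod (iT := IT_Gt) (iT' := IT_Gt))
  (iT' := IT_prod (iT := IT_prod (iT := IT_Gt) (iT' := IT_Gt)) (iT' := IT_Gt))
  (fun p : GT * GT => p.1 + p.2).
Proof.
exists plus => -[[a b] c] /=; rewrite -(app_eq _ (gadd_fun hG)); last first.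
  by apply/in_eprod_pair; split; exact: elP.
by split=> [->//|H]; apply: elv_inj; rewrite -H.
Qed.

Definition GZ : izmod hM := IZmod iterm_addG.

Lemma elv_gsign i (g : GT) : elv (if odd i then - g else g) = gsign G plus i (elv g).
Proof. by rewrite /gsign; case: odd. Qed.

End CoefficientGroup.

Section ChainGroups.
Context {M : eps_structure} {hM : ZC M} {G plus : M}.
Hypothesis hG : abelian_group G plus.
Variable X : M.
Local Notation GT := (GZ (hM := hM) hG).

Definition simplex (p : nat) : Type := tup (El X) p.+1.
Definition chainX (p : nat) : izmod hM := chainZ (tup (El X) p.+1) GT.

Lemma ran_tup n : ran (tup (El X) n) = epow X n :> M.
Proof. by elim: n => [//|n IH] /=; rewrite -IH. Qed.

Lemma code_tupof n (b : 'I_n -> El X) :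
  code (fun i => elv (b i)) = enc (tupof b) :> M.
Proof.
elim: n b => [|n IH] b; first by rewrite /code enum_ord0.
by rewrite /code enum_ordSl /= -map_comp -(IH (fun i => b (lift ord0 i))).
Qed.

Lemma tupof_surj n (t : tup (El X) n) : exists b, tupof b = t.
Proof.
elim: n t => [|n IH] /=.
  by move=> []; exists (fun i : 'I_0 => False_rect _ (notF (ltn_ord i))).
move=> [x t]; have [b Hb] := IH t.
exists (fun i => if unlift ord0 i is Some k then b k else x).
rewrite unlift_none -Hb; congr (_, tupof _); apply/funext => i.
by rewrite liftK.
Qed.

Lemma elv_funP n (a : 'I_n -> M) : (forall i, a i \eps X) ->
  exists b : 'I_n -> El X, a = fun i => elv (b i).
Proof. by move=> aX; exists (fun i => MkEl (aX i)). Qed.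

Lemma lam_graph T T' {iT : IT M T} {iT' : IT M T'} (f : T -> T') (F : M -> M) :
  iterm f -> (forall t, F (enc t) = enc (f t)) -> lam (ran T) F = graph f.
Proof.
move=> Hf HF.
have Hs z : z \eps graph f <-> exists x, x \eps ran T /\ z = opair x (F x).
  rewrite (in_esub_of Hf); split=> [[[t y] /= [-> ->]]|[x [/ranP[t <-] ->]]].
    by exists (enc t); rewrite HF; split=> //; exact: enc_ran.
  by exists (t, f t); rewrite HF.
apply: ext => z; rewrite Hs; apply: in_setof.
by exists (graph f).
Qed.

Lemma enc_term p g x : enc (term g x : chainX p) = cterm X G plus p (elv g) (enc x).
Proof.
rewrite /cterm -ran_tup; apply/esym.
apply: lam_graph; first exact: ev_iterm.
move=> t; rewrite termE.
by case: asboolP => [->|H]; [rewrite eqxx|case: eqP => // /enc_inj].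
Qed.

Lemma enc_zero p : enc (0 : chainX p) = czero X G plus p.
Proof. by rewrite /czero -ran_tup; apply/esym/lam_graph => //; exact: ev_iterm. Qed.

Lemma app_enc p (c : chainX p) t : app (enc c) (enc t) = elv (c t).
Proof. exact: app_graph (ev_iterm c). Qed.

Lemma enc_add p (c d : chainX p) : enc (c + d) = cadd X plus p (enc c) (enc d).
Proof.
rewrite /cadd -ran_tup; apply/esym/lam_graph; first exact: ev_iterm.
by move=> t; rewrite !app_enc.
Qed.

(** This concerns the condition defining [chains] instead of membership, because a [setof] has the
    intended members only after some set is known to have them. The range of [chainX p] will be that
    set. *)
Lemma chains_def p z :
  (is_fun z (epow X p.+1) G /\ exists s, [/\ is_finite s, esub s (epow X p.+1) &
      forall sigma, sigma \eps epow X p.+1 -> ~ sigma \eps s ->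
        app z sigma = gzero G plus]) <-> exists c : chainX p, enc c = z.
Proof.
rewrite -ran_tup; split; last first.
  move=> [c <-]; split; first exact: graph_fun (ev_iterm c).
  have [s [Hs cs]] := supported_fin c.
  exists (enc s); split; first exact: kfin_is_finite.
    by apply/in_epower; exact: (enc_ran s).
  by apply/ran_all => t; rewrite in_esub_of_enc ?app_enc => [/cs ->|];
    last exact: isubP.
move=> [Hz [s [Hs sX zs]]].
have /ranP[ss Es] : s \eps ran (isub (tup (El X) p.+1)) by apply/in_epower.
subst s.
have {}Hz : is_fun z (ran (tup (El X) p.+1)) (ran GT) by exact: Hz.
have [f Ef] := is_fun_ifun Hz.
have Hf : exists s0 : isub (tup (El X) p.+1), kfin s0 /\
    forall x, ~ s0 x -> f x = 0.
  exists ss; split; first exact: is_finite_kfin.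
  move=> x nx; apply: elv_inj.
  have -> : elv (f x) = app z (enc x) by rewrite -Ef app_graph //; exact: ifunP.
  apply: zs; first exact: enc_ran.
  by rewrite in_esub_of_enc //; exact: isubP.
by exists (Chain (ifunP f) Hf).
Qed.

Lemma in_chains p z : z \eps chains X G plus p <-> exists c : chainX p, enc c = z.
Proof.
rewrite -chains_def; move: z; apply: in_setof; exists (ran (chainX p)) => z.
by rewrite ranP -chains_def.
Qed.

Lemma ran_chains p : ran (chainX p) = chains X G plus p.
Proof. by apply: ext => z; rewrite in_chains ranP. Qed.

Definition bd_term (p : nat) (g : GT) : simplex p.+1 -> chainX p :=
  delta (fun l : simplex p => term g l).

Lemma iterm_bd_term p : iterm (fun q : GT * simplex p.+1 => bd_term q.1 q.2).
Proof.
by apply: iterm_delta; exact: iterm_term0.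
Qed.

Lemma enc_bd_term p (g : GT) (b : 'I_p.+2 -> El X) :
  enc (bd_term g (tupof b)) = \big[cadd X plus p/czero X G plus p]_(i < p.+2)
    cterm X G plus p (gsign G plus i (elv g))
      (code (face i (fun k => elv (b k)))).
Proof.
rewrite /bd_term delta_tupof.
rewrite (big_morph _ (@enc_add p) (@enc_zero p)); apply: eq_bigr => i _.
rewrite -elv_gsign (code_tupof (fun k => b (lift i k))) -enc_term; congr enc.
case: odd => //.
by apply: chain_ext => y; rewrite oppE !termE; case: asboolP; rewrite ?oppr0.
Qed.

Lemma is_bdP p D : is_bd X G plus p D <-> exists f : ifun (chainX p.+1) (chainX p),
  [/\ graph f = D, addmap f & forall g x, f (term g x) = bd_term g x].
Proof.
rewrite /is_bd -!ran_chains; split.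
  move=> [HD aD tD]; have [f fE] := is_fun_ifun HD; subst D.
  exists f; split=> // [c d|g x]; apply: enc_inj.
    rewrite enc_add -!(app_graph _ (ifunP f)) enc_add.
    by apply: aD; exact: enc_ran.
  have [b Eb] := tupof_surj x; subst x.
  rewrite -(app_graph _ (ifunP f)) enc_bd_term -tD //; last 2 first.
  - exact: elP.
  - by move=> i; exact: elP.
  by rewrite enc_term code_tupof.
move=> [f [<- af tf]]; split; first exact: graph_fun (ifunP f).
  move=> c d /ranP[c' <-] /ranP[d' <-]; rewrite -enc_add.
  by rewrite !(app_graph _ (ifunP f)) af enc_add.
move=> g a gG /elv_funP[b ->].
rewrite code_tupof -[g]/(elv (MkEl gG : GT)) -enc_term (app_graph _ (ifunP f)).
by rewrite tf enc_bd_term.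
Qed.

Lemma bd_spec p : exists D : chainX p.+1 -> chainX p, [/\ iterm D, addmap D,
  forall g x, D (term g x) = bd_term g x &
  forall c, bd X G plus p (enc c) = enc (D c)].
Proof.
have [D [iD aD DE]] : exists D : chainX p.+1 -> chainX p, [/\ iterm D, addmap D &
    forall g x, D (term g x) = bd_term g x].
  apply: hom_extension; first exact: iterm_bd_term.
  move=> x g h; rewrite /bd_term -deltaD; apply: eq_delta => l; exact: termD.
exists D; split=> // c.
(* [bd] takes whichever boundary map [get] picks. One exists, namely the graph of [D], and any other
   agrees with it on one-term chains, hence everywhere. *)
have /is_bdP[f [fE af tf]] : is_bd X G plus p (get [set D | is_bd X G plus p D]).
  apply: (getPex (P := [set D | is_bd X G plus p D])); exists (graph D) => /=.
  by apply/is_bdP; exists (exist _ _ iD).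
rewrite /bd -fE app_graph; last exact: ifunP.
congr enc; apply: (addmap_eq (E := D)) => //; first exact: ifunP.
by move=> g x; rewrite tf DE.
Qed.

Definition bdT p : chainX p.+1 -> chainX p := projT1 (cid (bd_spec p)).

Lemma iterm_bdT p : iterm (@bdT p).
Proof. by rewrite /bdT; case: cid => D /= []. Qed.

Lemma addmap_bdT p : addmap (@bdT p).
Proof. by rewrite /bdT; case: cid => D /= []. Qed.

Lemma bdT_term p g x : bdT (term g x : chainX p.+1) = bd_term g x.
Proof. by rewrite /bdT; case: cid => D /= []. Qed.

Lemma enc_bdT p (c : chainX p.+1) : bd X G plus p (enc c) = enc (bdT c).
Proof. by rewrite /bdT; case: cid => D /= []. Qed.

End ChainGroups.

(** * Induced chain maps and the prism homotopy *)

Section InducedMaps.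
Context {M : eps_structure} {hM : ZC M} {G plus : M}.
Hypothesis hG : abelian_group G plus.
Local Notation GT := (GZ (hM := hM) hG).
Local Notation C := (chainX (hM := hM) hG).

Lemma push_spec (X Y : M) (h : El X -> El Y) p : iterm h ->
  exists D : C X p -> C Y p, [/\ iterm D, addmap D &
    forall g x, D (term g x) = term g (tmap (n := p.+1) h x)].
Proof.
move=> Hh; apply: hom_extension; last by move=> x a b; exact: termD.
apply: iterm_term; first by int.
apply: (iterm_comp (f := fun q : GT * simplex X p => q.2) (iterm_tmap p.+1 Hh)).
by int.
Qed.

Definition push (X Y : M) (h : El X -> El Y) p (Hh : iterm h) : C X p -> C Y p :=
  projT1 (cid (push_spec p Hh)).

Lemma pushP X Y (h : El X -> El Y) p (Hh : iterm h) :
  [/\ iterm (push (p := p) Hh), addmap (push (p := p) Hh) &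
    forall g x, push Hh (term g x) = term g (tmap (n := p.+1) h x)].
Proof. by rewrite /push; case: cid. Qed.

Lemma push_term X Y (h : El X -> El Y) p (Hh : iterm h) g x :
  push Hh (term g x : C X p) = term g (tmap (n := p.+1) h x).
Proof. by have [_ _ ->] := pushP p Hh. Qed.

Lemma addmap_push X Y (h : El X -> El Y) p (Hh : iterm h) : addmap (push (p := p) Hh).
Proof. by have [] := pushP p Hh. Qed.

Lemma iterm_push X Y (h : El X -> El Y) p (Hh : iterm h) : iterm (push (p := p) Hh).
Proof. by have [] := pushP p Hh. Qed.

Lemma push_bdT X Y (h : El X -> El Y) p (Hh : iterm h) (c : C X p.+1) :
  bdT (push Hh c) = push Hh (bdT c).
Proof.
move: c; apply: addmap_eq.
- exact: iterm_comp (iterm_bdT _ _ _) (iterm_push _ Hh).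
- exact: iterm_comp (iterm_push _ Hh) (iterm_bdT _ _ _).
- by move=> a b; rewrite addmap_push addmap_bdT.
- by move=> a b; rewrite addmap_bdT addmap_push.
move=> g x; rewrite push_term !bdT_term /bd_term.
rewrite (addmap_delta _ _ (addmap_push Hh)) delta_tmap.
by apply: eq_delta => l; rewrite push_term.
Qed.

Lemma push_comp X Y Z (h : El X -> El Y) (k : El Y -> El Z) (m : El X -> El Z) p
  (Hh : iterm h) (Hk : iterm k) (Hm : iterm m) (c : C X p) :
  (forall x, m x = k (h x)) -> push Hk (push Hh c) = push Hm c.
Proof.
move=> E; move: c; apply: addmap_eq.
- exact: iterm_comp (iterm_push _ _) (iterm_push _ _).
- exact: iterm_push.
- by move=> a b; rewrite !addmap_push.
- exact: addmap_push.
move=> g x; rewrite !push_term; congr term.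
suff H n (l : tup (El X) n) : tmap k (tmap h l) = tmap m l by exact: H.
by elim: n l => [//|n IH] l /=; rewrite IH E.
Qed.

Lemma push_id X (h : El X -> El X) p (Hh : iterm h) (c : C X p) :
  (forall x, h x = x) -> push Hh c = c.
Proof.
move=> E; move: c; apply: (addmap_eq (E := id)) => //; first exact: iterm_push.
- exact: iterm_id.
- exact: addmap_push.
move=> g x; rewrite push_term; congr term.
suff H n (l : tup (El X) n) : tmap h l = l by exact: H.
by elim: n l => [|n IH] [] //= y l; rewrite IH E.
Qed.

Variables (X : M) (r : El X -> El X).
Hypothesis Hr : iterm r.

Definition prism_term p (g : GT) (x : simplex X p) : C X p.+1 :=
  prism r (fun l : simplex X p.+1 => term g l) x.

Lemma prismT_spec p : exists D : C X p -> C X p.+1, [/\ iterm D, addmap D &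
    forall g x, D (term g x) = prism_term g x].
Proof.
apply: hom_extension.
  apply: iterm_prism => //; last exact: iterm_term0.
  by move=> m; exact: iterm_tmap.
move=> x a b; rewrite /prism_term -prismD; apply: eq_prism => l; exact: termD.
Qed.

Definition prismT p : C X p -> C X p.+1 := projT1 (cid (prismT_spec p)).

Lemma iterm_prismT p : iterm (@prismT p).
Proof. by rewrite /prismT; case: cid => D /= []. Qed.
Lemma addmap_prismT p : addmap (@prismT p).
Proof. by rewrite /prismT; case: cid => D /= []. Qed.
Lemma prismT_term p g x : prismT (term g x : C X p) = prism_term g x.
Proof. by rewrite /prismT; case: cid => D /= []. Qed.

Lemma bdT_prism_term p g (x : simplex X p) :
  bdT (prism_term g x) = prism r (delta (fun l : simplex X p => term g l)) x :> C X p.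
Proof.
rewrite /prism_term (addmap_prism _ _ _ (@addmap_bdT _ _ _ _ hG X p)).
by apply: eq_prism => l; rewrite bdT_term.
Qed.

Lemma homotopy0 (c : C X 0) : bdT (prismT c) = push Hr c - c.
Proof.
move: c; apply: addmap_eq.
- exact: iterm_comp (iterm_bdT _ _ _) (iterm_prismT _).
- by apply: iterm_sub; [exact: iterm_push|exact: iterm_id].
- by move=> a b; rewrite addmap_prismT addmap_bdT.
- by move=> a b; rewrite addmap_push opprD addrACA.
move=> g x; rewrite prismT_term push_term bdT_prism_term -prism_delta.
(* In degree 0 the second summand of [prism_delta] is a prism on the empty tuple, which is 0. *)
by case: x => x [] /=; rewrite addr0.
Qed.

Lemma homotopyS p (c : C X p.+1) :
  prismT (bdT c) + bdT (prismT c) = push Hr c - c.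
Proof.
move: c; apply: addmap_eq.
- apply: iterm_add.
    exact: iterm_comp (iterm_prismT _) (iterm_bdT _ _ _).
  exact: iterm_comp (iterm_bdT _ _ _) (iterm_prismT _).
- by apply: iterm_sub; [exact: iterm_push|exact: iterm_id].
- by move=> a b; rewrite !(addmap_prismT, addmap_bdT) addrACA.
- by move=> a b; rewrite addmap_push opprD addrACA.
move=> g x; rewrite prismT_term push_term bdT_prism_term -prism_delta addrC.
congr (_ + _); rewrite bdT_term /bd_term (addmap_delta _ _ (@addmap_prismT p)).
by apply: eq_delta => l; rewrite prismT_term.
Qed.

End InducedMaps.

(** * Vertices of simplices and support conditions on chains *)

Section VertexSets.

Fixpoint tmem (T : Type) (x : T) (n : nat) : tup T n -> Prop :=
  if n is m.+1 return tup T n -> Prop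
  then fun l => x = l.1 \/ tmem x l.2 else fun=> False.

Lemma tmem_tupof (T : Type) n (b : 'I_n -> T) x : tmem x (tupof b) <-> exists i, x = b i.
Proof.
elim: n b => [|n IH] b /=; first by split=> // -[[]].
rewrite IH; split=> [[->|[i ->]]|[i ->]]; [by exists ord0|by exists (lift ord0 i)|].
by case: (unliftP ord0 i) => [k ->|->]; [right; exists k|left].
Qed.

Lemma tmem_tmap (T T' : Type) (h : T -> T') y k (l : tup T k) :
  tmem y (tmap h l) -> exists z, tmem z l /\ y = h z.
Proof.
elim: k l => [//|k IH] [z l] /= [->|/IH[t [tl ->]]].
  by exists z; split=> //; left.
by exists t; split=> //; right.
Qed.

Variables (T : Type) (V : zmodType).
Variable Z : V -> Prop.
Hypotheses (Z0 : Z 0) (ZB : forall a b, Z a -> Z b -> Z (a - b)).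

(** The prism evaluates f only at tuples whose vertices are vertices of [l] or their images under
    [r], and then combines the values by subtraction. *)
Lemma prism_closed r n (f : tup T n.+1 -> V) l :
  (forall l', (forall x, tmem x l' -> tmem x l \/ exists y, tmem y l /\ x = r y) ->
    Z (f l')) -> Z (prism r f l).
Proof.
elim: n f l => [//|n IH] f [x l] H.
apply: ZB.
  apply: H => y [->|[->|]]; first by left; left.
    by right; exists x; split=> //; left.
  by move=> /(@tmem_tmap _ _ _ _ _ _)[z [zl ->]]; right; exists z; split=> //; right.
apply: IH => l' Hl'; apply: H => y [->|/Hl'[|[z [zl ->]]]].
- by left; left.
- by left; right.
- by right; exists z; split=> //; right.
Qed.

End VertexSets.

Section Microchains.
Context {M : eps_structure} {hM : ZC M} {G plus : M}.
Hypothesis hG : abelian_group G plus.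
Local Notation GT := (GZ (hM := hM) hG).
Local Notation C := (chainX (hM := hM) hG).

Definition microT (T : Type) (R : T -> T -> Prop) n (l : tup T n) : Prop :=
  forall x y, tmem x l -> tmem y l -> R x y.

(** A condition on the support, independent of any way of writing [c] as a formal sum. The relation
    [R] may be external, so this need not be an internal predicate. *)
Definition microC (X : M) (R : El X -> El X -> Prop) p (c : C X p) : Prop :=
  forall l : simplex X p, c l <> 0 -> microT R l.

Variables (X : M) (R : El X -> El X -> Prop).

Lemma microC0 p : microC R (0 : C X p).
Proof. by move=> l []. Qed.

Lemma microCB p (c d : C X p) : microC R c -> microC R d -> microC R (c - d).
Proof.
move=> Hc Hd l cd; have [c0|] := EM (c l = 0); last exact: Hc.
by apply: Hd => d0; apply: cd; rewrite addE oppE c0 d0 subr0.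
Qed.

Lemma microCN p (c : C X p) : microC R c -> microC R (- c).
Proof. by move=> H; rewrite -sub0r; apply: microCB => //; exact: microC0. Qed.

Lemma microCD p (c d : C X p) : microC R c -> microC R d -> microC R (c + d).
Proof. by move=> Hc Hd; rewrite -[d]opprK; apply: microCB => //; exact: microCN. Qed.

Lemma microC_term p g (l : simplex X p) : microT R l -> microC R (term g l : C X p).
Proof. by move=> Hl l' H; have [->//|ne] := EM (l' = l); case: H; exact: term_neq. Qed.

Variables (Y : M) (R' : El Y -> El Y -> Prop).

(** Since [R] and [R'] may be external, the induction runs over internal sets instead: the support
    of [c], and the set [i1] of simplices occurring in the images of terms on that support. *)
Lemma microC_hom p q (D : C X p -> C Y q) : iterm D -> addmap D ->
  (forall g l, microT R l -> microC R' (D (term g l))) ->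
  forall c, microC R c -> microC R' (D c).
Proof.
move=> iD aD HD c Hc.
have i0 : internal (fun l : simplex X p => c l <> 0).
  by have ic := ev_iterm c; int.
have i1 : internal (fun l' : simplex Y q => exists (g : GT) (l : simplex X p),
    isub_of i0 l /\ (D (term g l)) l' <> 0) by int.
have Hs : supported (isub_of i1) (D c).
  apply: (@chain_ind _ _ _ _ _ (fun d => supported (isub_of i1) (D d)) (isub_of i0)).
  - by rewrite /supported; int.
  - by move=> l _; rewrite addmap0.
  - move=> d g l Hl IH; rewrite aD; apply: supported_add => // l' Hl'.
    by apply: contrapT => H; apply: Hl'; exists g, l.
  - by move=> l /contrapT.
move=> l' Hl'; have [g [l [Hl HDl]]] : isub_of i1 l'.
  by apply: contrapT => /Hs.
exact: (HD g l (Hc l Hl) l' HDl).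
Qed.

End Microchains.

(** * Microchains are the chains supported on microsimplices *)

Section FormalSums.
Context {M : eps_structure} {hM : ZC M} {S : Type} {iS : IT M S} {V : izmod hM}.
Local Notation C := (chainZ S V).

Definition formal (s0 : isub S) (n : NN M) (g : ifun (NN M) V) (s : ifun (NN M) S)
    (P : ifun (NN M) C) : Prop :=
  (forall i, ltN i n -> s0 (s i)) /\ P zeroN = 0 /\
  (forall i, ltN i n -> P (succN i) = P i + term (g i) (s i)).

Lemma succN_neq (i n : NN M) : ltN i n -> succN i <> succN n.
Proof.
move=> lt_in E; have : ltN n (succN i) by rewrite E; exact: ltNSn.
move=> /ltNS[/(ltN_trans lt_in)|En]; first exact: ltNn.
by rewrite En in lt_in; exact: ltNn lt_in.
Qed.

Lemma ltN_neq (i n : NN M) : ltN i n -> i <> n.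
Proof. by move=> lt_in E; rewrite E in lt_in; exact: ltNn lt_in. Qed.

Lemma ltNSS (i n : NN M) : ltN i n -> ltN (succN i) (succN n).
Proof.
move: n i; apply: (NN_ind (P := fun n => forall i, ltN i n -> ltN (succN i) (succN n))).
- by int.
- by move=> i /ltN0.
- move=> n IH i /ltNS[/IH lt_in|->]; last exact: ltNSn.
  by apply: ltN_trans lt_in (ltNSn _).
Qed.

Lemma ltN0S (n : NN M) : ltN zeroN (succN n).
Proof.
move: n; apply: NN_ind; [by int|exact: ltNSn|].
by move=> n Hn; apply: ltN_trans Hn (ltNSn _).
Qed.

Lemma update_ex T {iT : IT M T} (f : ifun (NN M) T) (n : NN M) (v : T) :
  exists f' : ifun (NN M) T, f' n = v /\ forall i, i <> n -> f' i = f i.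
Proof.
have Hf : iterm (fun i => if `[< i = n >] then v else f i) by int.
by exists (exist _ _ Hf); split=> [|i ne]; rewrite {1}/ifun_fun /=; case: asboolP.
Qed.

(** Each new term lengthens the sum by one, changing the coefficients and simplices at [n] and the
    partial sums at [succN n]. [x0] is the dummy value of the simplex sequence for the empty sum,
    internal sequences being total. *)
Lemma formal_ex (s0 : isub S) (c : C) (x0 : S) : supported s0 c ->
  exists n g s P, formal s0 n g s P /\ P n = c.
Proof.
move: c; apply: chain_ind.
- by rewrite /formal; int.
- have i0 : iterm (fun _ : NN M => 0 : V) by int.
  have i1 : iterm (fun _ : NN M => x0) by int.
  have i2 : iterm (fun _ : NN M => 0 : C) by int.
  exists zeroN, (exist _ _ i0), (exist _ _ i1), (exist _ _ i2).
  by split=> //; split=> [i /ltN0|] //; split=> // i /ltN0.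
move=> c g0 x Hx [n [g [s [P [[Hs [P0 PS]] Pn]]]]].
have [g' [g'n g'i]] := update_ex g n g0.
have [s' [s'n s'i]] := update_ex s n x.
have [P' [P'n P'i]] := update_ex P (succN n) (c + term g0 x).
exists (succN n), g', s', P'; split; last by [].
have ne0 : zeroN <> succN n := ltN_neq (ltN0S n).
split.
  move=> i /ltNS[lt_in|->]; rewrite ?s'n // s'i; [exact: Hs|exact: ltN_neq].
split; first by rewrite P'i.
move=> i /ltNS[lt_in|->].
  rewrite P'i; last exact: succN_neq.
  rewrite P'i; last by apply: ltN_neq; apply: ltN_trans (ltNSn n).
  by rewrite g'i ?s'i ?PS //; exact: ltN_neq.
rewrite P'n g'n s'n P'i ?Pn //.
by apply: ltN_neq; exact: ltNSn.
Qed.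

End FormalSums.

Section MicrochainsOfStar.
Context {U I : eps_structure} {hI : ZC I} {star : U -> I} {G plus : I}.
Hypothesis hG : abelian_group G plus.
Variables (X Ent : U).
Local Notation SX := (star X).
Local Notation GT := (GZ (hM := hI) hG).
Local Notation C := (chainX (hM := hI) hG SX).

Definition nearE (Y : I) (x y : El Y) : Prop := near star Ent (elv x) (elv y).

Lemma microsimplexP p (l : simplex SX p) :
  microsimplex star X Ent p (enc l) <-> microT (@nearE SX) l.
Proof.
split=> [[a [El aX Ra]]|Hl].
  have [b Eb] := elv_funP aX; subst a; move: El; rewrite code_tupof => /enc_inj ->.
  by move=> x y /tmem_tupof[i ->] /tmem_tupof[k ->]; exact: Ra.
have [b Eb] := tupof_surj l; subst l.
exists (fun i => elv (b i)); split; first by rewrite code_tupof.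
  by move=> i; exact: elP.
by move=> i k; apply: Hl; apply/tmem_tupof; eexists.
Qed.

(* The partial sums of a formal sum are supported on the simplices that occur
   in it, by induction on the internal natural numbers. *)
Lemma microchain_microC p z : microchain star X Ent G plus p z ->
  exists c : C p, enc c = z /\ microC (@nearE SX) c.
Proof.
move=> [n0 [g [s [/(in_omega hI) n0P Hg Hs Hm [P [HP P0 PS Pz]]]]]].
pose (n := MkEl n0P : NN I).
have HG : internal (fun q : NN I * simplex SX p => opair (elv q.1) (enc q.2) \eps s).
  by exists s.
have HQ : internal (fun q : NN I * C p => opair (elv q.1) (enc q.2) \eps P).
  by exists P.
have i0 : internal (fun l : simplex SX p =>
    exists k, ltN k n /\ opair (elv k) (enc l) \eps s).
  int; by apply: (int_comp (f := fun q : simplex SX p * NN I => (q.2, q.1)) HG); int.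
have in_P (i : NN I) : ltN i (succN n) -> elv i \eps esucc n0 by [].
have chP (i : NN I) : ltN i (succN n) -> exists c : C p, enc c = app P (elv i).
  by move=> Hi; apply/in_chains; exact: app_in HP (in_P _ Hi).
have main : forall i, ltN i (succN n) -> forall c : C p,
    opair (elv i) (enc c) \eps P -> supported (isub_of i0) c.
  apply: NN_ind.
  - by rewrite /supported; int.
  - move=> H0 c /(app_eq _ HP (in_P _ H0)); rewrite P0 -(enc_zero hG).
    by move=> /enc_inj <- l.
  move=> i IH Hi c; have lt_in : ltN i n.
    by have /ltNS[/(ltN_trans (ltNSn i))|<-] := Hi; [|exact: ltNSn].
  have Hi' : ltN i (succN n) by apply/ltNS; left.
  move=> /(app_eq _ HP (in_P _ Hi)); rewrite PS //.
  have [d Ed] := chP i Hi'; rewrite -Ed.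
  have Hgi : app g (elv i) \eps G by exact: app_in Hg lt_in.
  have /ranP[l El] : app s (elv i) \eps ran (simplex SX p).
    by rewrite ran_tup; exact: app_in Hs lt_in.
  rewrite -El -[app g _]/(elv (MkEl Hgi : GT)) -enc_term -enc_add.
  move=> /enc_inj <-; apply: supported_add.
    by apply: IH => //; apply/(app_eq _ HP (in_P _ Hi')).
  apply: supported_term; exists i; split=> //.
  by apply/(app_eq _ Hs lt_in).
have [c Ec] := chP n (ltNSn n).
exists c; split; first by rewrite Ec.
move=> l Hl; have [k [lt_kn kl]] : isub_of i0 l.
  apply: contrapT => /(main n (ltNSn n) c) H; apply: Hl; apply: H.
  exact/(app_eq _ HP (in_P _ (ltNSn n))).
apply/microsimplexP; have <- : app s (elv k) = enc l by apply/(app_eq _ Hs lt_kn).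
exact: Hm.
Qed.

Lemma formal_sum_formal p (s0 : isub (simplex SX p)) n g s P c :
  formal (V := GT) s0 n g s P -> P n = c ->
  formal_sum SX G plus p (elv n) (restr g n) (restr s n) (enc c).
Proof.
move=> [Hs [P0 PS]] Pn; exists (restr P (succN n)).
have appP i : ltN i (succN n) -> app (restr P (succN n)) (elv i) = enc (P i).
  by move=> Hi; apply: app_restr => //; exact: ifunP.
split.
- apply: (restr_fun (ifunP P)) => i _; apply/in_chains.
  by exists (P i).
- have := appP zeroN (ltN0S n); rewrite /= P0 => ->; exact: enc_zero.
- move=> x /[dup] xn /ltN_elt[i Ei]; subst x.
  have lt_in : ltN i n by [].
  have -> : app (restr P (succN n)) (esucc (elv i)) = enc (P (succN i)).
    exact: appP (succN i) (ltNSS lt_in).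
  have -> : app (restr P (succN n)) (elv i) = enc (P i).
    by apply: appP; apply/ltNS; left.
  rewrite !app_restr //; try exact: ifunP.
  by rewrite PS // -enc_term -enc_add.
- by rewrite appP ?Pn //; exact: ltNSn.
Qed.

Lemma microC_microchain p (c : C p) : microC (@nearE SX) c ->
  microchain star X Ent G plus p (enc c).
Proof.
move=> Hc; have [[l0 l0P]|c0] := EM (exists l, c l <> 0).
  (* The sum is formed over the support of [c], an internal set of microsimplices. *)
  have i0 : internal (fun l : simplex SX p => c l <> 0).
    by have ic := ev_iterm c; int.
  have [|n [g [s [P [HP Pn]]]]] := @formal_ex _ _ _ _ GT (isub_of i0) c l0.
    by move=> l /contrapT.
  exists (elv n), (restr g n), (restr s n); split.
  - by apply/in_omega; exact: elP.
  - by apply: (restr_fun (ifunP g)) => i _; exact: elP.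
  - apply: (restr_fun (ifunP s)) => i _; rewrite -ran_tup; exact: enc_ran.
  - move=> x /[dup] xn /ltN_elt[i Ei]; subst x.
    rewrite app_restr //; last exact: ifunP.
    by apply/microsimplexP; apply: Hc; exact: HP.1.
  - exact: formal_sum_formal HP Pn.
(* The zero chain is the empty sum with empty sequences; this covers an empty space, where there is
   no simplex to serve as a dummy. *)
have -> : c = 0 by apply: chain_ext => l; apply: contrapT => Hl; apply: c0; exists l.
exists eempty, eempty, eempty; split.
- by apply/in_omega; exact: (elP zeroN).
- by split=> x /in_eempty.
- by split=> x /in_eempty.
- by move=> i /in_eempty.
have iz : iterm (fun _ : NN I => 0 : C p) by int.
exists (restr (fun _ : NN I => 0 : C p) (succN zeroN)).
have E : app (restr (fun _ : NN I => 0 : C p) (succN zeroN)) eempty = enc (0 : C p).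
  exact: (app_restr iz (ltNSn zeroN)).
split=> //; last by move=> i /in_eempty.
  by apply: (restr_fun (n := succN zeroN) iz) => i _; apply/in_chains; eexists.
by rewrite E; exact: enc_zero.
Qed.

End MicrochainsOfStar.

(** * The infinitesimal retraction onto a dense subspace *)

(** The type consists of one formula whose parameter [V] varies over the class [E], with [star] as
    the map of parameters. Finite satisfiability is checked in the standard universe and carried
    over by transfer. *)
Lemma saturation_dfn (U I : eps_structure) (star : U -> I) :
  elementary star -> succ_saturated U I ->
  forall (P : U -> U -> Prop) (Q : I -> I -> Prop) (E : U -> Prop),
  dfn2 star (fun e => P (e 0) (e 1)) (fun e => Q (e 0) (e 1)) ->
  (forall n (q : 'I_n -> U), (forall i, E (q i)) -> exists x, forall i, P x (q i)) ->
  exists x, forall V, E V -> Q x (star V).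
Proof.
move=> hstar hsat P Q E hPQ hfin; have tr := dfn2_transfer hstar hPQ.
have [phi [a [_ HQ]]] := hPQ.
pose rho n := if a n is inl 0 then 0%N else n.+1.
(* The predicate reads variables 0 and 1, so every variable other than 0 may be set to [V]. *)
pose e' V n := match a n with inl k => V | inr m => m end.
have satE x V : sat (scons x (star \o e' V)) (ren rho phi) <-> Q x (star V).
  rewrite sat_ren; suff -> : scons x (star \o e' V) \o rho =
      penv star a (scons x (fun=> star V)) by rewrite -HQ.
  apply/funext => n; rewrite /penv /rho /e' /=.
  by case En: (a n) => [[|k]|m] //=; rewrite En.
pose T psi e := exists V, [/\ E V, psi = ren rho phi & e = e' V].
have [|x Hx] := hsat star T; last first.
  by exists x => V EV; apply/satE; apply: Hx; exists V.
move=> n q Hq; have [V HV] := choice Hq.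
have [|x Px] := hfin n V; first by move=> i; have [] := HV i.
exists (star x) => i; have [_ -> ->] := HV i; apply/satE.
exact: (tr (scons x (fun=> V i))).1 (Px i).
Qed.

Section UniformTransfer.
Context {U I : eps_structure} {star : U -> I}.
Hypotheses (hU : ZC U) (hI : ZC I) (hstar : elementary star).
Context {X Ent A : U}.
Hypotheses (hX : uniform_space X Ent) (hA : dense_in X Ent A).

Lemma star_sub : esub (star A) (star X).
Proof.
have H : forall x, x \eps A -> x \eps X := hA.1.
suff : forall x, x \eps star A -> x \eps star X by [].
by apply: (sentence_transfer hstar _ H); dfn hU hI.
Qed.

Lemma near_refl x : x \eps star X -> near star Ent x x.
Proof.
move=> xX V EV; move: x xX.
have H : forall x, x \eps X -> opair x x \eps V by move=> x; exact: (unif_refl hX).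
by apply: (sentence_transfer hstar _ H); dfn hU hI.
Qed.

Lemma near_sym x y : near star Ent x y -> near star Ent y x.
Proof.
move=> xy V EV; have [W [EW HW]] := unif_sym hX EV.
have : forall x y, opair x y \eps star W -> opair y x \eps star V.
  by apply: (sentence_transfer hstar _ HW); dfn hU hI.
by apply; exact: xy.
Qed.

Lemma near_trans y x z : near star Ent x y -> near star Ent y z -> near star Ent x z.
Proof.
move=> xy yz V EV; have [W [EW HW]] := unif_comp hX EV.
have : forall x y z, opair x y \eps star W -> opair y z \eps star W ->
    opair x z \eps star V.
  by apply: (sentence_transfer hstar _ HW); dfn hU hI.
by move/(_ x y z); apply; [exact: xy|exact: yz].
Qed.

Lemma in_cap (V W z : U) : z \eps setof [set z | z \eps V /\ z \eps W] <->
  z \eps V /\ z \eps W.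
Proof.
move: z; apply: in_setof.
have [s Hs] : exists s, forall z, z \eps s <-> z \eps V /\ z \eps W.
  by apply: dfn_separation => //; dfn hU hU.
by exists s.
Qed.

Lemma in_sub_uniformity (W : U) : W \eps sub_uniformity A Ent <->
  exists V, V \eps Ent /\ W = setof [set z | z \eps V /\ z \eps eprod A A].
Proof.
move: W; apply: in_setof.
have [s Hs] : exists s, forall W, W \eps s <-> W \eps epower (eprod A A) /\
    exists V, V \eps Ent /\ forall z, z \eps W <-> z \eps V /\ z \eps eprod A A.
  by apply: dfn_separation => //; dfn hU hU.
exists s => W; rewrite Hs; split=> [[_ [V [EV WV]]]|[V [EV ->]]].
  by exists V; split=> //; apply: (ext hU) => z; rewrite WV in_cap.
split; last by exists V; split=> // z; rewrite in_cap.
by apply/(in_epower hU) => z /in_cap[].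
Qed.

Lemma near_sub x y : x \eps star A -> y \eps star A ->
  near star (sub_uniformity A Ent) x y <-> near star Ent x y.
Proof.
move=> xA yA; split=> H V.
  move=> EV.
  have {H} : opair x y \eps star (setof [set z | z \eps V /\ z \eps eprod A A]).
    by apply: H; apply/in_sub_uniformity; exists V.
  move: x y {xA yA}; set W := setof _.
  have H : forall x y, opair x y \eps W -> opair x y \eps V.
    by move=> x y /in_cap[].
  by apply: (sentence_transfer hstar _ H); dfn hU hI.
move=> /in_sub_uniformity[W [EW VE]].
have {}H := H W EW; move: x y xA yA H.
have H : forall x y, x \eps A -> y \eps A -> opair x y \eps W -> opair x y \eps V.
  by move=> x y xA yA xyW; rewrite VE in_cap; split=> //; apply/(in_eprod_pair hU).
by apply: (sentence_transfer hstar _ H); dfn hU hI.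
Qed.

(** Spelled out with membership and pairs so that [dfn] can handle it. Fixing [A] pointwise is what
    later makes r i the identity. *)
Definition retraction_within (M : eps_structure) (X A r V : M) : Prop :=
  (forall z, z \eps r -> exists x y, x \eps X /\ y \eps A /\ z = opair x y) /\
  (forall x, x \eps X -> exists y, opair x y \eps r /\
     forall y', opair x y' \eps r -> y = y') /\
  (forall x, x \eps A -> opair x x \eps r) /\
  (forall x y, opair x y \eps r -> opair x y \eps V).

Lemma dfn2_retraction_within : dfn2 star
  (fun e => retraction_within X A (e 0%N) (e 1%N))
  (fun e => retraction_within (star X) (star A) (e 0%N) (e 1%N)).
Proof. by rewrite /retraction_within; dfn hU hI. Qed.

Lemma dense_approx (V x : U) : V \eps Ent -> x \eps X ->
  exists y, y \eps A /\ opair x y \eps V /\ (x \eps A -> y = x).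
Proof.
move=> EV xX; have [xA|xA] := EM (x \eps A).
  by exists x; split=> //; split=> //; exact: (unif_refl hX).
have [N HN] : exists N, forall y, y \eps N <-> y \eps X /\ opair x y \eps V.
  by apply: dfn_separation => //; dfn hU hU.
have [|a [aA aN]] := hA.2 x N xX.
  split; first by move=> y /HN[].
  exists V; split=> // y xyV; apply/HN; split=> //.
  by have /(in_eprod_pair hU)[] := unif_sub hX EV xyV.
by exists a; split=> //; split=> [|//]; have /HN[] := aN.
Qed.

Lemma retraction_within_ex (V : U) : V \eps Ent -> exists r, retraction_within X A r V.
Proof.
move=> EV.
(* The fibre over [x] consists of pairs with first entry [x], not of bare points [y]: this makes the
   fibres disjoint, as [zc_choice] demands. *)
pose (good := fun x z => exists y, y \eps A /\ (z = opair x y /\ (opair x y \eps V /\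
  (x \eps A -> y = x)))).
have [F HF] : exists F, forall Z, Z \eps F <-> Z \eps epower (eprod X A) /\
    exists x, x \eps X /\ forall z, z \eps Z <-> good x z.
  by apply: dfn_separation => //; rewrite /good; dfn hU hU.
have fiber x : x \eps X -> exists Z, Z \eps F /\ forall z, z \eps Z <-> good x z.
  move=> xX; have [Z HZ] : exists Z, forall z,
      z \eps Z <-> z \eps eprod X A /\ good x z.
    by apply: dfn_separation => //; rewrite /good; dfn hU hU.
  have HZ' z : z \eps Z <-> good x z.
    rewrite HZ; split=> [[]//|gz]; split=> //; have [y [yA [-> _]]] := gz.
    exact/(in_eprod_pair hU).
  exists Z; split=> //; apply/HF; split; last by exists x.
  by apply/(in_epower hU) => z /HZ[].
have [T HT] : exists T, forall Z, Z \eps F -> exists! z, z \eps Z /\ z \eps T.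
  apply: (zc_choice hU) => [Z /HF[_ [x [xX HZ]]]|Z Z' z].
    have [y [yA [xyV yx]]] := dense_approx EV xX.
    by exists (opair x y); apply/HZ; exists y.
  move=> /HF[_ [x [_ HZ]]] /HF[_ [x' [_ HZ']]] /HZ[y [_ [-> _]]].
  move=> /HZ'[y' [_ [/(opair_inj hU)[xx' _] _]]].
  by apply: (ext hU) => t; rewrite HZ HZ' xx'.
(* [T] meets each fibre once but may have elements outside all fibres, so it is cut down. *)
have [r Hr] : exists r, forall z, z \eps r <-> z \eps eprod X A /\
    (z \eps T /\ exists x, x \eps X /\ good x z).
  by apply: dfn_separation => //; rewrite /good; dfn hU hU.
have rE x y : opair x y \eps r -> x \eps X /\ good x (opair x y) /\ opair x y \eps T.
  move=> /Hr[_ [xyT [x' [x'X gx']]]].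
  have [y' [_ [/(opair_inj hU)[xx' _] _]]] := gx'.
  by subst x'.
have rI x y : x \eps X -> good x (opair x y) -> opair x y \eps T -> opair x y \eps r.
  move=> xX gxy xyT; apply/Hr; split; last by split=> //; exists x.
  have [y' [y'A [/(opair_inj hU)[_ ->] _]]] := gxy.
  exact/(in_eprod_pair hU).
have tot x : x \eps X -> exists y, opair x y \eps r /\
    forall y', opair x y' \eps r -> y = y'.
  move=> xX; have [Z [ZF HZ]] := fiber x xX.
  have [z [[zZ zT] zu]] := HT Z ZF.
  have /HZ gz := zZ; have [y [_ [zE _]]] := gz; subst z.
  exists y; split; first exact: rI.
  move=> y' /rE[_ [gy' y'T]].
  have /(opair_inj hU)[] // : opair x y = opair x y'.
  by apply: zu; split=> //; apply/HZ.
exists r; split; first by move=> z /Hr[/(in_eprod hU)[x [y [xX yA ->]]] _]; exists x, y.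
split=> //; split.
  move=> x xA; have [y [xyr _]] := tot x (hA.1 _ xA).
  have [_ [[y' [_ [/(opair_inj hU)[_ yy'] [_ y'x]]]] _]] := rE _ _ xyr.
  by rewrite -{2}(y'x xA) -yy'.
by move=> x y /rE[_ [[y' [_ [-> []]]]]].
Qed.

Lemma entourage_cap n (q : 'I_n -> U) : (forall i, q i \eps Ent) ->
  exists W, W \eps Ent /\ forall i, esub W (q i).
Proof.
elim: n q => [|n IH] q Hq.
  by exists (eprod X X); split=> [|[]//]; exact: (unif_full hX).
have [W [EW HW]] := IH (fun i => q (lift ord0 i)) (fun i => Hq _).
exists (setof [set z | z \eps W /\ z \eps q ord0]); split; first exact: (unif_cap hX).
move=> i z /in_cap[zW z0]; case: (unliftP ord0 i) => [k ->|->] //.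
exact: HW.
Qed.

Lemma infinitesimal_retraction : succ_saturated U I ->
  exists r : El (star X) -> El (star A), [/\ iterm r,
    forall x, near star Ent (elv x) (elv (r x)) &
    forall x y, elv x = elv y -> r x = y].
Proof.
move=> hsat.
have [R HR] : exists R, forall V, V \eps Ent ->
    retraction_within (star X) (star A) R (star V).
  (* For finitely many entourages, a retraction that stays within one [W] contained in all of them
     serves. *)
  apply: (saturation_dfn hstar hsat dfn2_retraction_within) => n q Hq.
  have [W [EW HW]] := entourage_cap Hq.
  have [r [H1 [H2 [H3 H4]]]] := retraction_within_ex EW.
  by exists r => i; split=> //; split=> //; split=> // x y /H4/HW.
(* The first three conditions do not involve the entourage; the full one guarantees that there is an
   instance to read them from. *)
have HX := unif_full hX; have [R1 [R2 [R3 _]]] := HR _ HX.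
have HF : is_fun R (ran (El (star X))) (ran (El (star A))).
  by split=> // z /R1[x [y [xX [yA ->]]]]; apply/(in_eprod_pair hI).
have [r rE] := is_fun_ifun HF.
have inR x : opair (elv x) (elv (r x)) \eps R.
  by rewrite -rE; apply/(in_graph _ _ (ifunP r)).
exists r; split; first exact: ifunP.
  by move=> x V EV; have [_ [_ [_]]] := HR V EV; apply.
move=> x y xy; apply/esym/(in_graph x y (ifunP r)); rewrite rE.
have := R3 (elv y) (elP y); by rewrite -{1}xy.
Qed.

End UniformTransfer.

(** * Homology classes *)

Section HomologyClasses.
Context {U I : eps_structure} {hI : ZC I} {star : U -> I} {G plus : I}.
Hypothesis hG : abelian_group G plus.
Variables (X Ent : U).
Local Notation SX := (star X).
Local Notation C := (chainX (hM := hI) hG SX).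
Local Notation micro := (microC (@nearE _ _ star Ent SX)).

Definition cyc p : C p -> Prop :=
  if p is q.+1 return C p -> Prop then fun c => bdT c = 0 else fun=> True.

Definition homology_class p (z : C p) : set I :=
  [set c | exists d : C p.+1, micro d /\ c = enc (z + bdT d)].

Lemma cycleP p c : cycle star X Ent G plus p c <->
  exists z : C p, [/\ enc z = c, micro z & cyc z].
Proof.
split.
  move=> [/(microchain_microC hG)[z [<- Hz]] Bz]; exists z; split=> //.
  case: p z Hz Bz => [//|q] z _; rewrite enc_bdT -(enc_zero hG).
  exact: enc_inj.
move=> [z [<- Hz Cz]]; split; first exact: microC_microchain.
case: p z Hz Cz => [//|q] z _ /= Cz.
by rewrite enc_bdT Cz enc_zero.
Qed.

Lemma boundaryP p b : boundary star X Ent G plus p b <->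
  exists d : C p.+1, micro d /\ b = enc (bdT d).
Proof.
split=> [[c [/(microchain_microC hG)[d [<- Hd]] ->]]|[d [Hd ->]]].
  by exists d; split=> //; exact: enc_bdT.
exists (enc d); split; first exact: microC_microchain.
by apply/esym; exact: enc_bdT.
Qed.

Lemma homologyP p S : homology star X Ent G plus p S <->
  exists z : C p, [/\ micro z, cyc z & S = homology_class z].
Proof.
have E (z : C p) : [set c | exists b, boundary star X Ent G plus p b /\
    c = cadd SX plus p (enc z) b] = homology_class z.
  apply/seteqP; split=> c /=.
    move=> [b [/boundaryP[d [Hd ->]] ->]]; exists d; split=> //.
    by rewrite enc_add.
  move=> [d [Hd ->]]; exists (enc (bdT d)); split; last exact: enc_add.
  by apply/boundaryP; exists d.
split=> [[c [/cycleP[z [<- Hz Cz]] ->]]|[z [Hz Cz ->]]].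
  by exists z; split.
by exists (enc z); split; [apply/cycleP; exists z|].
Qed.

Lemma homology_class_eq p (z w : C p) :
  homology_class z = homology_class w <->
  exists d : C p.+1, micro d /\ z = w + bdT d.
Proof.
split=> [E|[d [Hd ->]]].
  have : homology_class w (enc z).
    rewrite -E; exists 0; split; first exact: microC0.
    by rewrite (addmap0 (@addmap_bdT _ _ _ _ hG SX p)) addr0.
  by move=> [d [Hd /enc_inj]]; exists d.
apply/seteqP; split=> c [e [He ->]].
  exists (d + e); split; first exact: microCD.
  by rewrite addmap_bdT addrA.
exists (e - d); split; first exact: microCB.
rewrite addmap_bdT (addmapN _ (@addmap_bdT _ _ _ _ hG SX p)).
by rewrite addrACA subrr addr0.
Qed.

Lemma homology_class_add p (z w : C p) :
  homology_add star X plus p (homology_class z) (homology_class w) =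
  homology_class (z + w).
Proof.
apply/seteqP; split=> c.
  move=> [s [t [[d [Hd ->]] [e [He ->]] ->]]]; exists (d + e).
  split; first exact: microCD.
  by rewrite -enc_add addmap_bdT addrACA.
move=> [d [Hd ->]]; exists (enc z), (enc (w + bdT d)); split.
- exists 0; split; first exact: microC0.
  by rewrite (addmap0 (@addmap_bdT _ _ _ _ hG SX p)) addr0.
- by exists d.
- by rewrite -enc_add addrA.
Qed.

End HomologyClasses.

(** * The isomorphism induced by the inclusion of the dense subspace *)

Section DenseSubspace.
Context {U I : eps_structure} {star : U -> I}.
Hypotheses (hU : ZC U) (hI : ZC I) (hstar : elementary star).
Context {X Ent A : U} {G plus : I}.
Hypotheses (hX : uniform_space X Ent) (hA : dense_in X Ent A).
Hypothesis hG : abelian_group G plus.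
Local Notation SX := (star X).
Local Notation SA := (star A).
Local Notation EntA := (sub_uniformity A Ent).
Local Notation CX := (chainX (hM := hI) hG SX).
Local Notation CA := (chainX (hM := hI) hG SA).
Local Notation RX := (@nearE _ _ star Ent SX).
Local Notation RA := (@nearE _ _ star EntA SA).

Definition incl (x : El SA) : El SX := MkEl (star_sub hstar hA (elP x)).

Lemma iterm_incl : iterm incl.
Proof.
apply: (@internal_dfn _ _ _ _ (fun x => exists y, x = opair y y)); first by dfn hI hI.
move=> [x y] /=; split=> [->|[z /(opair_inj hI)[<- E]]]; first by exists (elv x).
exact: elv_inj.
Qed.

Lemma microT_incl n (l : tup (El SA) n) : microT RA l -> microT RX (tmap incl l).
Proof.
move=> H x y /(@tmem_tmap _ _ _ _ _ _)[a [al ->]] /(@tmem_tmap _ _ _ _ _ _)[b [bl ->]].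
exact: (near_sub hU hI hstar (elP a) (elP b)).1 (H _ _ al bl).
Qed.

Lemma microC_push_incl p (c : CA p) : microC RA c -> microC RX (push iterm_incl c).
Proof.
have [iD aD tD] := pushP hG p iterm_incl.
apply: microC_hom => // g l Hl; rewrite tD.
exact: microC_term (microT_incl Hl).
Qed.

Variable r : El SX -> El SA.
Hypotheses (Hr : iterm r) (rnear : forall x, near star Ent (elv x) (elv (r x)))
  (rid : forall x y, elv x = elv y -> r x = y).

Lemma near_r x y : near star Ent (elv x) (elv y) ->
  near star Ent (elv (r x)) (elv (r y)).
Proof.
move=> xy; apply: (near_trans hU hI hstar hX (y := elv x)).
  exact: (near_sym hU hI hstar hX).
exact: (near_trans hU hI hstar hX xy).
Qed.

Lemma microT_r n (l : tup (El SX) n) : microT RX l -> microT RA (tmap r l).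
Proof.
move=> H x y /(@tmem_tmap _ _ _ _ _ _)[a [al ->]] /(@tmem_tmap _ _ _ _ _ _)[b [bl ->]].
exact: (near_sub hU hI hstar (elP (r a)) (elP (r b))).2 (near_r (H _ _ al bl)).
Qed.

Lemma microC_push_r p (c : CX p) : microC RX c -> microC RA (push Hr c).
Proof.
have [iD aD tD] := pushP hG p Hr.
apply: microC_hom => // g l Hl; rewrite tD.
exact: microC_term (microT_r Hl).
Qed.

Lemma iterm_ir : iterm (fun x => incl (r x)).
Proof. exact: iterm_comp iterm_incl Hr. Qed.

Lemma microC_prismT p (c : CX p) : microC RX c ->
  microC RX (prismT iterm_ir c).
Proof.
apply: microC_hom; [exact: iterm_prismT|exact: addmap_prismT|].
move=> g l Hl; rewrite prismT_term; apply: prism_closed.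
- exact: microC0.
- by move=> a b; exact: microCB.
move=> l' Hl'; apply: microC_term => x y /Hl' Hx /Hl' Hy.
(* Each vertex of a prism simplex is infinitely close to some vertex of [l], and the vertices of [l]
   are close to one another. *)
have near_l z : tmem z l \/ (exists y, tmem y l /\ z = incl (r y)) ->
    exists2 t, tmem t l & near star Ent (elv t) (elv z).
  move=> [zl|[t [tl ->]]]; last by exists t => //; exact: rnear.
  by exists z => //; apply: (near_refl hU hI hstar hX); exact: elP.
have [s sl sx] := near_l x Hx; have [t tl ty] := near_l y Hy.
apply: (near_trans hU hI hstar hX (y := elv s)); first exact: (near_sym hU hI hstar hX).
by apply: (near_trans hU hI hstar hX (y := elv t)) => //; exact: Hl.
Qed.

Lemma push_incl_r p (z : CX p) : microC RX z -> cyc z ->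
  exists d : CX p.+1, microC RX d /\ push iterm_incl (push Hr z) = z + bdT d.
Proof.
move=> Hz Cz; exists (prismT iterm_ir z); split; first exact: microC_prismT.
rewrite (push_comp (m := fun x => incl (r x)) _ _ iterm_ir) //.
suff -> : bdT (prismT iterm_ir z) = push iterm_ir z - z by rewrite addrC subrK.
case: p z Hz Cz => [|p] z _ Cz; first exact: homotopy0.
rewrite -homotopyS [bdT z]Cz.
by rewrite (addmap0 (@addmap_prismT _ _ _ _ hG _ _ iterm_ir p)) add0r.
Qed.

Lemma push_r_incl p (z : CA p) : push Hr (push iterm_incl z) = z.
Proof.
rewrite (push_comp (m := id) _ _ (iterm_id (T := El SA))).
  by apply: push_id.
by move=> x; rewrite (rid (y := x)).
Qed.

Lemma cyc_push (Y Z : U) (h : El (star Y) -> El (star Z)) (Hh : iterm h) p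
  (z : chainX (hM := hI) hG (star Y) p) : cyc z -> cyc (push Hh z).
Proof.
case: p z => [//|p] z /= Cz.
by rewrite push_bdT Cz (addmap0 (@addmap_push _ _ _ _ hG _ _ _ p Hh)).
Qed.

(** All representatives are pushed forward and all boundaries added, so no representative has to be
    chosen and the map makes sense on arbitrary sets of codes. *)
Definition homology_incl p (S : set I) : set I :=
  [set c | exists (s : CA p) (b : CX p.+1), [/\ S (enc s), microC RX b &
     c = enc (push iterm_incl s + bdT b)]].

Lemma homology_inclE p (z : CA p) :
  homology_incl p (homology_class EntA z) = homology_class Ent (push iterm_incl z).
Proof.
apply/seteqP; split=> c.
  move=> [s [b [[d [Hd /enc_inj ->]] Hb ->]]].
  exists (push iterm_incl d + b); split.
    by apply: microCD => //; exact: microC_push_incl.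
  by rewrite addmap_push addmap_bdT push_bdT addrA.
move=> [d [Hd ->]]; exists z, d; split=> //.
exists 0; split; first exact: microC0.
by rewrite (addmap0 (@addmap_bdT _ _ _ _ hG SA p)) addr0.
Qed.

Lemma homology_incl_iso p : group_isomorphic
    (homology star A EntA G plus p) (homology_add star A plus p)
    (homology star X Ent G plus p) (homology_add star X plus p).
Proof.
exists (homology_incl p); split; last first.
  move=> S T /(homologyP hG)[z [_ _ ->]] /(homologyP hG)[w [_ _ ->]].
  rewrite homology_class_add !homology_inclE homology_class_add.
  by rewrite addmap_push.
split.
- move=> S /(homologyP hG)[z [Hz Cz ->]]; apply/(homologyP hG).
  exists (push iterm_incl z); split; [exact: microC_push_incl|exact: cyc_push|].
  exact: homology_inclE.
- move=> S T /set_mem/(homologyP hG)[z [Hz Cz ->]].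
  move=> /set_mem/(homologyP hG)[w [Hw Cw ->]].
  rewrite !homology_inclE => /homology_class_eq[d [Hd E]].
  (* Injectivity: if i z = i w + bd d, applying r gives z = w + bd (r d). *)
  apply/homology_class_eq; exists (push Hr d); split; first exact: microC_push_r.
  by rewrite -[LHS]push_r_incl E addmap_push push_r_incl push_bdT.
- move=> S /(homologyP hG)[z [Hz Cz ->]].
  (* Surjectivity: the class of [z] comes from that of r z, as i r z and [z] differ by the boundary
     of the prism of [z]. *)
  exists (homology_class EntA (push Hr z)).
    apply/(homologyP hG); exists (push Hr z); split=> //.
      exact: microC_push_r.
    exact: cyc_push.
  rewrite homology_inclE; apply/homology_class_eq; exact: push_incl_r.
Qed.

End DenseSubspace.

Theorem corollary13 (U I : eps_structure) (star : U -> I)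
    (hU : ZC U) (hstar : elementary star) (hsat : succ_saturated U I)
    (X Ent A : U) (hX : uniform_space X Ent) (hA : dense_in X Ent A)
    (G plus : I) (hG : abelian_group G plus) (p : nat) :
  group_isomorphic
    (homology star A (sub_uniformity A Ent) G plus p)
    (homology_add star A plus p)
    (homology star X Ent G plus p)
    (homology_add star X plus p).
Proof.
have hI := ZC_transfer hU hstar.
have [r [Hr rnear rid]] := infinitesimal_retraction hU hI hstar hX hA hsat.
exact: (homology_incl_iso hU hstar hX hA hG Hr rnear rid).
Qed.
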